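(* Let $\Gamma\subset I(\mathbb{R}^n)$ be a Bieberbach group and $M_\Gamma=\Gamma\backslash\mathbb{R}^n$. (i) If $\gamma=BL_b\in\Gamma$, then $\gamma$ preserves the lines $o_\gamma+u+\mathbb{R}b_+$, with $u\in\ker(B-\mathrm{Id})$. Furthermore $\gamma\,\alpha_{\gamma,u}(t)=\alpha_{\gamma,u}(t+1)$. Any line in $\mathbb{R}^n$ stable by $\gamma$ is of the form $o_\gamma+u+\mathbb{R}b_+$ for some $u\in\ker(B-\mathrm{Id})$. (ii) The geodesic $\alpha_{\gamma,u}$ pushes down to a closed geodesic $\bar\alpha_{\gamma,u}(t)$ in $M_\Gamma$, $t\in\mathbb{Z}\backslash\mathbb{R}$, of length $l(\bar\alpha_{\gamma,u})=\|b_+\|$. Any closed geodesic in $M_\Gamma$ is of the form $\bar\alpha_{\gamma,u}$ for some $\gamma=BL_b\in\Gamma$ and $u\in\ker(B-\mathrm{Id})$. (iii) $\bar\alpha_{\gamma,u}$ is freely homotopic to $\bar\alpha_\gamma$. The holonomy of $\bar\alpha_{\gamma,u}$ is given by $[B^\perp]$, where $B^\perp$ denotes the restriction of $B$ to $(\mathbb{R}b_+)^\perp$. (iv) The $L$-spectrum (resp. $L_c$-spectrum) of $M_\Gamma$ is the set of numbers $\|b_+\|$ (resp. the set of pairs $(\|b_+\|,[B^\perp])$), where $BL_b$ runs through all elements of $\Gamma$. (v) The $[L]$-spectrum (resp. $[L_c]$-spectrum) of $M_\Gamma$ is the set of numbers $\|b_+\|$ (resp. the set of pairs $(\|b_+\|,[B^\perp])$),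 counted with multiplicities, where $\gamma=BL_b$ runs through a full set of representatives for the $\Gamma$-conjugacy classes in $\Gamma$.
   Context: $I(\mathbb{R}^n)$ is the isometry group of $\mathbb{R}^n$; each element is written uniquely as $BL_b$ with $B\in O(n)$, $b\in\mathbb{R}^n$, where $L_b$ is translation by $b$, so $BL_b(x)=B(x+b)$. A Bieberbach group is a discrete, cocompact, torsion-free subgroup of $I(\mathbb{R}^n)$. For $\gamma=BL_b\in\Gamma$ write $b=b_++b'$ with $b_+\in\ker(B-\mathrm{Id})$ and $b'\in\ker(B-\mathrm{Id})^\perp$; one has $b_+\ne0$ when $\gamma\neq\mathrm{Id}$. Let $o_\gamma$ be the unique element of $\ker(B-\mathrm{Id})^\perp$ with $(B-\mathrm{Id})o_\gamma=-Bb'$ (it exists and is unique since $B-\mathrm{Id}$ restricts to an isomorphism of $\ker(B-\mathrm{Id})^\perp$). For $u\in\ker(B-\mathrm{Id})$ and $t\in\mathbb{R}$ put $\alpha_{\gamma,u}(t)=o_\gamma+u+t\,b_+$ and $\alpha_\gamma=\alpha_{\gamma,0}$; $\bar\alpha_{\gamma,u}$, $\bar\alpha_\gamma$ denote their images in $M_\Gamma$. A closed geodesic is a periodic geodesic, considered with a (not necessarily minimal) period, which may be normalized to $1$; its length $l(\alpha)\ge 0$ is the length over one such period (length $0$ is allowed, corresponding to the class of the identity). If $\alpha$ is a closed geodesic in $M_\Gamma$ with period $t_o$, parallel transport along $\alpha$ from $\alpha(0)$ to $\alpha(t_o)=\alpha(0)$ fixes $\dot\alpha(0)$, so it defines an element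 $V\in O((\mathbb{R}\dot\alpha(0))^\perp)\simeq O(n-1)$; its conjugacy class $[V]$ in $O(n-1)$ is the holonomy of $\alpha$, and the complex length of $\alpha$ is the pair $(l(\alpha),[V])$. Likewise $[B^\perp]$ is the conjugacy class defined by $B^\perp$. Length and complex length depend only on the free homotopy class of $\alpha$. Free homotopy classes of closed paths in $M_\Gamma$ correspond bijectively to conjugacy classes in $\Gamma$. The multiplicity of a length (resp. complex length) is the number of free homotopy classes having that length (resp. complex length). The $L$-spectrum (resp. $L_c$-spectrum) of $M_\Gamma$ is the set of all lengths (resp. complex lengths) of closed geodesics in $M_\Gamma$; the $[L]$-spectrum (resp. $[L_c]$-spectrum) is the set of lengths (resp. complex lengths) of closed geodesics, with multiplicities.
   Formalization: In (i), the last sentence (any line stable by γ is of the form o_γ+u+ℝb_+) is stated only for γ≠Id; for γ=Id every line is stable while b_+=0, so o_γ+u+ℝb_+ is a point and the claim fails. *)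

(* Defs.v *)
From HB Require Import structures.
From mathcomp Require Import all_boot all_order all_algebra generic_quotient.
From mathcomp Require Import all_classical all_reals all_analysis.

Set Implicit Arguments.
Unset Strict Implicit.
Unset Printing Implicit Defensive.

Import Order.TTheory GRing.Theory Num.Theory.
Import numFieldNormedType.Exports.

Local Open Scope classical_set_scope.
Local Open Scope ring_scope.
Local Open Scope quotient_scope.

(* The library norm on 'cV[R]_n is the sup norm; it is used only for the
   topology and for derivatives.  Metric notions use [enorm]. *)
Definition dotp (R : realType) (n : nat) (x y : 'cV[R]_n) : R :=
  \sum_(i < n) x i ord0 * y i ord0.

Definition enorm (R : realType) (n : nat) (x : 'cV[R]_n) : R :=
  Num.sqrt (dotp x x).

Definition is_isometry (R : realType) (n : nat) (f : 'cV[R]_n -> 'cV[R]_n) :=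
  forall x y, enorm (f x - f y) = enorm (x - y).

Definition orthogonal_mx (R : realType) (n : nat) (B : 'M[R]_n) :=
  B^T *m B = 1%:M.

(* The isometry B L_b, with L_b the translation by b. *)
Definition BL (R : realType) (n : nat) (B : 'M[R]_n) (b x : 'cV[R]_n) :
  'cV[R]_n := B *m (x + b).

Record isom_group (R : realType) (n : nat) := IsomGroup {
  isom_set :> ('cV[R]_n -> 'cV[R]_n) -> Prop ;
  isom_setP : forall g, isom_set g -> is_isometry g ;
  isom_id : isom_set id ;
  isom_comp : forall g h, isom_set g -> isom_set h -> isom_set (g \o h) ;
  isom_inv : forall g, isom_set g ->
    exists2 h, isom_set h & cancel g h /\ cancel h g
}.

Section FlatManifold.
Context {R : realType} {n : nat} (Gamma : isom_group R n).
Local Notation V := 'cV[R]_n.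

Definition orbit_rel (x y : V) : bool := `[< exists2 g, Gamma g & g x = y >].

Fact orbit_rel_refl : reflexive orbit_rel.
Proof. by move=> x; apply/asboolP; exists id => //; exact: isom_id. Qed.

Fact orbit_rel_sym : symmetric orbit_rel.
Proof.
have sub x y : orbit_rel x y -> orbit_rel y x.
  move=> /asboolP[g Gg <-]; have [h Gh [gh _]] := isom_inv Gg.
  by apply/asboolP; exists h.
by move=> x y; apply/idP/idP; exact: sub.
Qed.

Fact orbit_rel_trans : transitive orbit_rel.
Proof.
move=> y x z /asboolP[g Gg <-] /asboolP[h Gh <-].
by apply/asboolP; exists (h \o g) => //; exact: isom_comp.
Qed.

Definition orbit_equiv : equiv_rel V :=
  EquivRel orbit_rel orbit_rel_refl orbit_rel_sym orbit_rel_trans.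

(* M_Gamma, with its quotient topology. *)
Definition flat_manifold := quotient_topology {eq_quot orbit_equiv}.

Definition orbit_proj (x : V) : flat_manifold := \pi_flat_manifold x.

(* An isometry g is affine, so g (x + v) - g x is its differential applied
   to v; the tangent bundle of M_Gamma is the quotient of the trivial bundle
   over R^n by the differentials of the elements of Gamma. *)
Definition tangent_rel (p q : V * V) : bool :=
  `[< exists2 g, Gamma g & (g p.1, g (p.1 + p.2) - g p.1) = q >].

Fact tangent_rel_refl : reflexive tangent_rel.
Proof.
move=> [x v]; apply/asboolP; exists id; first exact: isom_id.
by rewrite /= addrC addKr.
Qed.

Fact tangent_rel_sym : symmetric tangent_rel.
Proof.
have sub p q : tangent_rel p q -> tangent_rel q p.
  case: p => x v /asboolP[g Gg <-] /=; have [h Gh [gh _]] := isom_inv Gg.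
  apply/asboolP; exists h => //=.
  by rewrite [g x + _]addrC subrK !gh [x + v]addrC addrK.
by move=> p q; apply/idP/idP; exact: sub.
Qed.

Fact tangent_rel_trans : transitive tangent_rel.
Proof.
move=> y [x v] z /asboolP[g Gg <-] /asboolP[h Gh <-] /=.
apply/asboolP; exists (h \o g); first exact: isom_comp.
by rewrite /= [g x + _]addrC subrK.
Qed.

Definition tangent_equiv : equiv_rel (V * V)%type :=
  EquivRel tangent_rel tangent_rel_refl tangent_rel_sym tangent_rel_trans.

Definition tangent_bundle := {eq_quot tangent_equiv}.

Definition tangent_proj (x v : V) : tangent_bundle := \pi_tangent_bundle (x, v).

(* Independent of the representative, Gamma acting by isometries. *)
Definition tnorm (X : tangent_bundle) : R := enorm (repr X).2.

Implicit Types (alpha : R -> flat_manifold).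

(* [orbit_proj] is a local isometry: geodesics of M_Gamma are the curves that
   lift locally to affinely parametrized straight lines.  Constant curves are
   allowed. *)
Definition geodesic alpha :=
  forall t : R, exists x v : V,
    \forall s \near t, alpha s = orbit_proj (x + (s - t) *: v).

(* The period is normalized to 1. *)
Definition closed_geodesic alpha :=
  geodesic alpha /\ forall t, alpha (t + 1) = alpha t.

Definition is_velocity alpha (t : R) (X : tangent_bundle) :=
  exists c : R -> V, [/\ \forall s \near t, alpha s = orbit_proj (c s),
    derivable c t 1 & X = tangent_proj (c t) (derive1 c t)].

Definition velocity alpha (t : R) : tangent_bundle :=
  xget (tangent_proj 0 0) [set X | is_velocity alpha t X].

Definition curve_length alpha : R :=
  \int[lebesgue_measure]_(t in `[0%R, 1%R]) tnorm (velocity alpha t).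

(* Parallel vector fields along a curve: the flat connection is the one for
   which they are locally constant when read in R^n along a local lift. *)
Definition parallel_along alpha (X : R -> tangent_bundle) :=
  forall t : R, exists (c : R -> V) (w : V), continuous c /\
    \forall s \near t, alpha s = orbit_proj (c s) /\ X s = tangent_proj (c s) w.

(* Y is the parallel transport of X along alpha, from time 0 to time 1. *)
Definition parallel_transport alpha (X Y : tangent_bundle) :=
  exists F, [/\ parallel_along alpha F, F 0 = X & F 1 = Y].

(* The columns of E form an orthonormal basis of the orthogonal of R v. *)
Definition perp_basis (v : V) (k : nat) (E : 'M[R]_(n, k)) :=
  E^T *m E = 1%:M /\
  forall w, dotp v w = 0 <-> exists c : 'cV[R]_k, w = E *m c.

(* For A orthogonal fixing v, the matrices of the restriction of A to the
   orthogonal of R v in all orthonormal bases of it: this is a conjugacy class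
   of O(n - 1) if v is nonzero, and of O(n) if v = 0 (closed geodesics of
   length 0, for which A is the identity). *)
Definition perp_class (A : 'M[R]_n) (v : V) : set {k : nat & 'M[R]_k} :=
  [set W | exists E : 'M[R]_(n, tag W),
    perp_basis v E /\ A *m E = E *m tagged W].

(* A is the matrix of the parallel transport along alpha, the tangent space at
   alpha 0 being identified with R^n by means of a point x above alpha 0. *)
Definition is_holonomy alpha (C : set {k : nat & 'M[R]_k}) :=
  exists (x v : V) (A : 'M[R]_n),
    [/\ velocity alpha 0 = tangent_proj x v,
        forall w, parallel_transport alpha (tangent_proj x w)
          (tangent_proj x (A *m w)) &
        C = perp_class A v].

Definition is_complex_length alpha (z : R * set {k : nat & 'M[R]_k}) :=
  curve_length alpha = z.1 /\ is_holonomy alpha z.2.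

Definition closed_path alpha :=
  continuous alpha /\ forall t, alpha (t + 1) = alpha t.

Definition freely_homotopic (alpha beta : R -> flat_manifold) :=
  exists H : R * R -> flat_manifold,
    [/\ {within `[0%R, 1%R] `*` [set: R], continuous H},
        forall s t : R, s \in `[0%R, 1%R] -> H (s, t + 1) = H (s, t),
        forall t, H (0, t) = alpha t &
        forall t, H (1, t) = beta t].

Definition is_free_homotopy_class (K : set (R -> flat_manifold)) :=
  exists2 alpha, closed_path alpha &
    K = [set beta | closed_path beta /\ freely_homotopic alpha beta].

Definition L_spectrum : set R :=
  [set l | exists2 alpha, closed_geodesic alpha & curve_length alpha = l].

Definition Lc_spectrum : set (R * set {k : nat & 'M[R]_k}) :=
  [set z | exists2 alpha, closed_geodesic alpha & is_complex_length alpha z].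

(* The multiplicity of l (resp. z) is the cardinality of the following set of
   free homotopy classes. *)
Definition classes_of_length (l : R) : set (set (R -> flat_manifold)) :=
  [set K | is_free_homotopy_class K /\
    exists alpha, [/\ K alpha, closed_geodesic alpha & curve_length alpha = l]].

Definition classes_of_complex_length (z : R * set {k : nat & 'M[R]_k}) :
    set (set (R -> flat_manifold)) :=
  [set K | is_free_homotopy_class K /\
    exists alpha, [/\ K alpha, closed_geodesic alpha &
      is_complex_length alpha z]].

(* Discreteness for the topology of I(R^n) = O(n) x R^n.  There is no need to
   require p.1 to be orthogonal: Gamma contains only isometries. *)
Definition discrete_isom_group :=
  forall (B : 'M[R]_n) (b : V), Gamma (BL B b) ->
    \forall p \near (B, b), Gamma (BL p.1 p.2) -> p = (B, b).

Definition torsion_free :=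
  forall (g : V -> V) (k : nat),
    Gamma g -> (forall x, iter k.+1 g x = x) -> forall x, g x = x.

Definition bieberbach :=
  [/\ discrete_isom_group, compact [set: flat_manifold] & torsion_free].

Definition conjugate_in (g h : V -> V) :=
  exists2 k, Gamma k & k \o g = h \o k.

Definition full_representatives (S : set (V -> V)) :=
  S `<=` Gamma /\ forall g, Gamma g -> exists! h, S h /\ conjugate_in g h.

End FlatManifold.

Arguments classes_of_length {R n} Gamma l.
Arguments classes_of_complex_length {R n} Gamma z.

Section Axis.
Context {R : realType} {n : nat}.
Implicit Types (B : 'M[R]_n) (b u w : 'cV[R]_n) (l : set 'cV[R]_n).

Definition fixed_space B : set 'cV[R]_n := [set u | (B - 1%:M) *m u = 0].

Definition fixed_space_perp B : set 'cV[R]_n :=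
  [set w | forall u, fixed_space B u -> dotp u w = 0].

(* b_+, the component of b in ker (B - Id). *)
Definition bplus B b : 'cV[R]_n :=
  xget 0 [set p | fixed_space B p /\ fixed_space_perp B (b - p)].

Definition bprime B b : 'cV[R]_n := b - bplus B b.

(* o_gamma for gamma = B L_b. *)
Definition axis_origin B b : 'cV[R]_n :=
  xget 0 [set o |
    fixed_space_perp B o /\ (B - 1%:M) *m o = - (B *m bprime B b)].

Definition axis B b u (t : R) : 'cV[R]_n :=
  axis_origin B b + u + t *: bplus B b.

Definition is_line l :=
  exists p v : 'cV[R]_n, v != 0 /\ l = range (fun t : R => p + t *: v).

End Axis.

(* Main.v *)
(* An isometry [B L_b] fixing no point translates along the affine subspace on
   which its displacement is minimal; splitting [b] along [ker (B - Id)] and its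
   orthogonal gives the parallel axes.  Since [Gamma] acts freely and properly
   discontinuously, [orbit_proj] has unique lifts: a closed geodesic lifts to a
   line that some [gamma] translates by one period, hence to an axis of [gamma],
   and two closed paths are freely homotopic exactly when their lifts close up
   along conjugate elements of [Gamma].  Parallel transport once around an axis
   is [B^-1] in the frame at the starting point; this is [B] up to conjugation
   because every real orthogonal matrix is conjugate to its transpose in the
   orthogonal group. *)
Require Import Defs.
From HB Require Import structures.
From mathcomp Require Import all_boot all_order all_algebra generic_quotient.
From mathcomp Require Import all_classical all_reals all_analysis.
From mathcomp Require Import ring lra.

Set Implicit Arguments.
Unset Strict Implicit.
Unset Printing Implicit Defensive.

Import Order.TTheory GRing.Theory Num.Theory.
Import numFieldNormedType.Exports.

Local Open Scope classical_set_scope.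
Local Open Scope ring_scope.
Local Open Scope card_scope.

(** * Euclidean geometry of column vectors *)

Section Euclidean.
Context {R : realType}.
Implicit Types n : nat.

(** Discreteness is a condition on the coefficients of the isometries, whereas freeness and proper
    discontinuity speak of orbits. The bridge is compactness of the orthogonal group: elements that
    move one point less and less have linear parts that cluster, so some element recurs, and absence
    of torsion then excludes fixed points. Cocompactness makes the radius of free action uniform,
    which allows a lift to be followed at all times at once while a closed path is deformed. Free
    homotopy classes are separated by one property of a closed path, that it has a lift closing up
    through a given element; this property is shown to be locally constant in the homotopy
    parameter. Connectedness of the real line then concludes, as it also does for uniqueness of
    lifts, extension of geodesics and uniqueness of parallel fields. Conjugacy with the transpose is
    obtained over the reals, by splitting off invariant subspaces of dimension at most two found by
    maximizing a quadratic form on a sphere. *)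

Lemma dotpE n (x y : 'cV[R]_n) : dotp x y = (x^T *m y) ord0 ord0.
Proof. by rewrite mxE; apply: eq_bigr => i _; rewrite mxE. Qed.

Lemma dotpC n (x y : 'cV[R]_n) : dotp x y = dotp y x.
Proof. by apply: eq_bigr => i _; rewrite mulrC. Qed.

Lemma dotpDl n (x y z : 'cV[R]_n) : dotp (x + y) z = dotp x z + dotp y z.
Proof. by rewrite -big_split; apply: eq_bigr => i _; rewrite mxE mulrDl. Qed.

Lemma dotpDr n (x y z : 'cV[R]_n) : dotp z (x + y) = dotp z x + dotp z y.
Proof. by rewrite dotpC dotpDl !(dotpC z). Qed.

Lemma dotpZl n a (x z : 'cV[R]_n) : dotp (a *: x) z = a * dotp x z.
Proof. by rewrite /dotp mulr_sumr; apply: eq_bigr => i _;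
  rewrite mxE mulrA. Qed.

Lemma dotpZr n a (x z : 'cV[R]_n) : dotp z (a *: x) = a * dotp z x.
Proof. by rewrite dotpC dotpZl dotpC. Qed.

Lemma dotpNl n (x z : 'cV[R]_n) : dotp (- x) z = - dotp x z.
Proof. by rewrite -scaleN1r dotpZl mulN1r. Qed.

Lemma dotpNr n (x z : 'cV[R]_n) : dotp z (- x) = - dotp z x.
Proof. by rewrite dotpC dotpNl dotpC. Qed.

Lemma dotpBl n (x y z : 'cV[R]_n) : dotp (x - y) z = dotp x z - dotp y z.
Proof. by rewrite dotpDl dotpNl. Qed.

Lemma dotpBr n (x y z : 'cV[R]_n) : dotp z (x - y) = dotp z x - dotp z y.
Proof. by rewrite dotpDr dotpNr. Qed.

Lemma dotp0l n (z : 'cV[R]_n) : dotp 0 z = 0.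
Proof. by rewrite -(scale0r z) dotpZl mul0r. Qed.

Lemma dotp_mulmxl n m (A : 'M[R]_(m, n)) x y :
  dotp (A *m x) y = dotp x (A^T *m y).
Proof. by rewrite !dotpE trmx_mul mulmxA. Qed.

Lemma dotp_ge0 n (x : 'cV[R]_n) : 0 <= dotp x x.
Proof. by apply: sumr_ge0 => i _; rewrite -expr2 sqr_ge0. Qed.

Lemma dotp_eq0 n (x : 'cV[R]_n) : dotp x x = 0 -> x = 0.
Proof.
move=> /eqP; rewrite psumr_eq0 => [/allP x0|i _];
  last by rewrite -expr2 sqr_ge0.
apply/colP => i; rewrite mxE; apply/eqP.
by have := x0 i (mem_index_enum _); rewrite -expr2 sqrf_eq0.
Qed.

Lemma enorm_ge0 n (x : 'cV[R]_n) : 0 <= enorm x.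
Proof. exact: sqrtr_ge0. Qed.

Lemma enorm_sqr n (x : 'cV[R]_n) : enorm x ^+ 2 = dotp x x.
Proof. by rewrite sqr_sqrtr// dotp_ge0. Qed.

Lemma enorm0 n : enorm (0 : 'cV[R]_n) = 0.
Proof. by rewrite /enorm dotp0l sqrtr0. Qed.

Lemma enorm_eq0 n (x : 'cV[R]_n) : enorm x = 0 -> x = 0.
Proof. by move=> x0; apply: dotp_eq0; rewrite -enorm_sqr x0 expr0n. Qed.

Lemma enorm_gt0 n (x : 'cV[R]_n) : x != 0 -> 0 < enorm x.
Proof.
by move=> x0; rewrite lt_def enorm_ge0 andbT;
  apply: contra_neq x0 => /enorm_eq0.
Qed.

Lemma enormN n (x : 'cV[R]_n) : enorm (- x) = enorm x.
Proof. by rewrite /enorm dotpNl dotpNr opprK. Qed.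

Lemma enormBC n (x y : 'cV[R]_n) : enorm (x - y) = enorm (y - x).
Proof. by rewrite -enormN opprB. Qed.

Lemma dotp_le_enorm n (x y : 'cV[R]_n) : dotp x y <= enorm x * enorm y.
Proof.
have [->|x0] := eqVneq x 0; first by rewrite dotp0l enorm0 mul0r.
have [->|y0] := eqVneq y 0; first by rewrite dotpC dotp0l enorm0 mulr0.
have a0 := enorm_gt0 x0; have b0 := enorm_gt0 y0.
(* Expanding this square gives twice [enorm x * enorm y] times the difference of the two sides. *)
have := dotp_ge0 (enorm y *: x - enorm x *: y).
rewrite !(dotpBl, dotpBr, dotpZl, dotpZr) -!enorm_sqr (dotpC y x) => h.
rewrite -(ler_pM2l (mulr_gt0 a0 b0)); nra.
Qed.

Lemma enormD n (x y : 'cV[R]_n) : enorm (x + y) <= enorm x + enorm y.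
Proof.
rewrite -(@ler_pXn2r _ 2)// ?nnegrE ?addr_ge0 ?enorm_ge0//.
rewrite sqrrD !enorm_sqr !(dotpDl, dotpDr) (dotpC y x).
by have := dotp_le_enorm x y; lra.
Qed.

Lemma enorm_dist n (y x z : 'cV[R]_n) :
  enorm (x - z) <= enorm (x - y) + enorm (y - z).
Proof. by apply: le_trans (enormD _ _); rewrite addrA subrK. Qed.

Lemma coord_le_enorm n (x : 'cV[R]_n) i : `|x i ord0| <= enorm x.
Proof.
rewrite -sqrtr_sqr ler_sqrt ?dotp_ge0// /dotp (bigD1 i)//= -expr2 lerDl.
by apply: sumr_ge0 => j _; rewrite -expr2 sqr_ge0.
Qed.

Lemma orthogonal_mxC n (B : 'M[R]_n) : orthogonal_mx B -> B *m B^T = 1%:M.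
Proof. exact: mulmx1C. Qed.

Lemma orthogonal_mx_tr n (B : 'M[R]_n) : orthogonal_mx B -> orthogonal_mx B^T.
Proof. by rewrite /orthogonal_mx trmxK => /orthogonal_mxC. Qed.

Lemma orthogonal_mxM n (B C : 'M[R]_n) :
  orthogonal_mx B -> orthogonal_mx C -> orthogonal_mx (B *m C).
Proof.
rewrite /orthogonal_mx => oB oC.
by rewrite trmx_mul -mulmxA (mulmxA B^T) oB mul1mx.
Qed.

Lemma orthogonal_mxK n m (B : 'M[R]_n) (x : 'M[R]_(n, m)) :
  orthogonal_mx B -> B^T *m (B *m x) = x.
Proof. by move=> oB; rewrite mulmxA oB mul1mx. Qed.

Lemma orthogonal_mxKV n m (B : 'M[R]_n) (x : 'M[R]_(n, m)) :
  orthogonal_mx B -> B *m (B^T *m x) = x.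
Proof. by move=> oB; rewrite mulmxA orthogonal_mxC// mul1mx. Qed.

Lemma enorm_orthogonal n (B : 'M[R]_n) x :
  orthogonal_mx B -> enorm (B *m x) = enorm x.
Proof. by move=> oB; rewrite /enorm dotp_mulmxl orthogonal_mxK. Qed.

Lemma BLD n (B : 'M[R]_n) b x v : BL B b (x + v) = BL B b x + B *m v.
Proof. by rewrite /BL addrAC mulmxDr. Qed.

(** Polarization shows that [f - f 0] preserves [dotp], so the matrix [B] of the images of the basis
    vectors satisfies [B^T *m f0 x = x]. Orthogonality of [B] and linearity of [f0] both follow from
    this single identity. *)
Lemma isometryP n (f : 'cV[R]_n -> 'cV[R]_n) : is_isometry f ->
  exists B b, orthogonal_mx B /\ f = BL B b.
Proof.
move=> isof; have [f0 f0E] : exists f0, forall x, f0 x = f x - f 0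
  by exists (fun x => f x - f 0).
have f0B x y : enorm (f0 x - f0 y) = enorm (x - y).
  by rewrite -[RHS]isof !f0E opprB addrA subrK.
have f0N x : enorm (f0 x) = enorm x.
  by have := f0B x 0; rewrite (f0E 0) subrr !subr0.
have f0dot x y : dotp (f0 x) (f0 y) = dotp x y.
  have := congr1 (fun t => t ^+ 2) (f0B x y).
  rewrite !enorm_sqr !(dotpBl, dotpBr) -!enorm_sqr !f0N !(dotpC y).
  rewrite (dotpC (f0 y)).
  by lra.
pose B : 'M[R]_n := \matrix_(i, j) f0 (delta_mx j ord0) i ord0.
have BTf x : B^T *m f0 x = x.
  apply/colP => i; rewrite -[RHS]mul1r.
  have -> : (B^T *m f0 x) i ord0 = dotp (f0 (delta_mx i ord0)) (f0 x).
    by rewrite mxE; apply: eq_bigr => j _; rewrite !mxE.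
  rewrite f0dot /dotp (bigD1 i)//= big1 ?addr0 ?mxE ?eqxx// => j ji.
  by rewrite mxE (negbTE ji) mul0r.
have oB : orthogonal_mx B.
  apply/matrixP => i j; transitivity ((delta_mx j ord0 : 'cV[R]_n) i ord0).
    rewrite -[delta_mx _ _ in RHS]BTf !mxE.
    by apply: eq_bigr => k _; rewrite !mxE.
  by rewrite !mxE andbT.
exists B, (B^T *m f 0); split=> //; apply/funext => x.
rewrite /BL mulmxDr orthogonal_mxKV// -[x in B *m x]BTf orthogonal_mxKV//.
by rewrite f0E subrK.
Qed.

End Euclidean.

(** * Topology of matrices *)

Section MatrixTopology.
Context {R : realType}.

Lemma cvg_mx T (F : set_system T) {FF : Filter F} m n (f : T -> 'M[R]_(m, n))
    (M : 'M[R]_(m, n)) :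
  (forall i j, f t i j @[t --> F] --> M i j) -> f @ F --> M.
Proof.
move=> cf A [P MP PA]; apply: (filterS (P := fun t
  => forall i j, P i j (f t i j))).
  by move=> t Pt; exact: PA.
by apply: filter_forall => i; apply: filter_forall => j; exact: cf.
Qed.

Lemma cvg_coord T (F : set_system T) {FF : Filter F} m n (f : T -> 'M[R]_(m, n))
    (M : 'M[R]_(m, n)) i j :
  f @ F --> M -> f t i j @[t --> F] --> M i j.
Proof. by move=> cf; exact: (cvg_comp _ (fun A : 'M[R]_(m, n)
  => A i j) cf (@coord_continuous _ _ _ i j M)). Qed.

Lemma cvg_mulmx T (F : set_system T) {FF : Filter F} m n p
    (f : T -> 'M[R]_(m, n)) (g : T ->
      'M[R]_(n, p)) (A : 'M[R]_(m, n)) (B : 'M[R]_(n, p)) :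
  f @ F --> A -> g @ F --> B -> f t *m g t @[t --> F] --> A *m B.
Proof.
move=> fA gB; apply: cvg_mx => i j.
under eq_cvg do rewrite mxE; rewrite mxE.
rewrite (_ : (fun x => _) = \sum_(k < n) (fun x => f x i k * g x k j));
  last first.
  by apply/funext => x; rewrite fct_sumE.
elim/big_rec2: _ => [|k y z _ zy]; first exact: cvg_cst.
by apply: cvgD => //; apply: cvgM; exact: cvg_coord.
Qed.

Lemma cvg_trmx T (F : set_system T) {FF : Filter F} m n
    (f : T -> 'M[R]_(m, n)) (A : 'M[R]_(m, n)) : f @ F --> A ->
      (f t)^T @[t --> F] --> A^T.
Proof.
move=> fA; apply: cvg_mx => i j; under eq_cvg do rewrite mxE.
by rewrite mxE; exact: cvg_coord.
Qed.

Lemma mulmx_continuous m n p (A : 'M[R]_(m, n)) :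
  continuous (fun B : 'M[R]_(n, p) => A *m B).
Proof. by move=> B; apply: (@cvg_mulmx _ (nbhs B));
  [exact: cvg_cst|exact: cvg_id]. Qed.

Lemma trmx_continuous m n : continuous (fun A : 'M[R]_(m, n) => A^T).
Proof. by move=> A; apply: (@cvg_trmx _ (nbhs A)); exact: cvg_id. Qed.

Lemma cvg_dotp T (F : set_system T) {FF : Filter F} n (f g : T ->
  'cV[R]_n) (x y : 'cV[R]_n) :
  f @ F --> x -> g @ F --> y -> dotp (f t) (g t) @[t --> F] --> dotp x y.
Proof.
move=> fx gy; rewrite dotpE; under eq_cvg do rewrite dotpE.
by apply: cvg_coord; apply: cvg_mulmx => //; exact: cvg_trmx.
Qed.

Lemma BL_continuous n (B : 'M[R]_n) b : continuous (BL B b).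
Proof.
move=> x; apply: (@cvg_mulmx _ (nbhs x)); first exact: cvg_cst.
by apply: cvgD; [exact: cvg_id|exact: cvg_cst].
Qed.

Lemma cvg_enorm T (F : set_system T) {FF : Filter F} n (f : T ->
  'cV[R]_n) (x : 'cV[R]_n) :
  f @ F --> x -> enorm (f t) @[t --> F] --> enorm x.
Proof.
by move=> fx; apply: (cvg_comp _ _ (cvg_dotp fx fx)); exact: sqrt_continuous.
Qed.

Lemma near_enorm n (x : 'cV[R]_n) e : 0 < e ->
  \forall y \near x, enorm (y - x) < e.
Proof.
move=> e0; have : enorm (y - x) @[y --> x] --> (0 : R).
  rewrite -(@enorm0 R n) -(subrr x); apply: (@cvg_enorm _ (nbhs x)).
  by apply: cvgB; [exact: cvg_id|exact: cvg_cst].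
by move/cvgr_lt; exact.
Qed.

Lemma near_enorm_comp T (F : set_system T) {FF : Filter F} n (f : T -> 'cV[R]_n)
    (x : 'cV[R]_n) e : f @ F --> x -> 0 < e ->
      \forall t \near F, enorm (f t - x) < e.
Proof. by move=> fx e0; exact: (fx _ (near_enorm x e0)). Qed.

(** Coordinates are bounded by the Euclidean norm, so Euclidean balls lie in balls of the sup norm;
    with [near_enorm], the two norms define the same topology. *)
Lemma nbhs_enorm n (x : 'cV[R]_n) (U : set 'cV[R]_n) : nbhs x U ->
  exists2 e, 0 < e & forall y, enorm (y - x) < e -> U y.
Proof.
move=> /nbhs_ballP[e /= e0 eU]; exists e => // y xy; apply: eU.
split=> // i j; rewrite ord1 -ball_normE /= distrC.
by apply: le_lt_trans xy; have := coord_le_enorm (y - x) i; rewrite !mxE.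
Qed.

Lemma cvg_enormP T (F : set_system T) {FF : Filter F} n (f : T ->
  'cV[R]_n) (x : 'cV[R]_n) :
  (forall e, 0 < e -> \forall t \near F, enorm (f t - x) < e) -> f @ F --> x.
Proof.
move=> h U /nbhs_enorm[e e0 eU]; apply: filterS (h e e0) => t; exact: eU.
Qed.

(** The cube of row vectors is a product of segments, and [vec_mx] carries it continuously onto the
    cube of matrices. *)
Lemma compact_cube m n :
  compact [set A : 'M[R]_(m, n) | forall i j, `|A i j| <= 1].
Proof.
have vc : continuous (@vec_mx R m n).
  move=> v; apply: (@cvg_mx _ (nbhs v)) => i j; under eq_cvg do rewrite mxE.
  by rewrite mxE; exact: coord_continuous.
have -> : [set A : 'M[R]_(m, n) | forall i j, `|A i j| <= 1] =
    vec_mx @` [set v : 'rV[R]_(m * n) |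
      forall k, `[(-1)%R, 1%R]%classic (v ord0 k)].
  apply/seteqP; split=> [A A1|_ [v v1 <-] i j].
    exists (mxvec A); last by rewrite mxvecK.
    by move=> k; case/mxvec_indexP: k => i j;
      rewrite mxvecE /= in_itv /= -ler_norml.
  by rewrite mxE ler_norml; have := v1 (mxvec_index i j); rewrite /= in_itv.
apply: continuous_compact; first exact/continuous_subspaceT.
by refine (@rV_compact R _ (fun=> `[(-1)%R, 1%R]%classic) _) => k;
  exact: segment_compact.
Qed.

Lemma orthogonal_mx_closed n : closed [set B : 'M[R]_n | orthogonal_mx B].
Proof.
have -> : [set B : 'M[R]_n | orthogonal_mx B] =
    \bigcap_i \bigcap_j
      [set B : 'M[R]_n | (B^T *m B) i j = (1%:M : 'M[R]_n) i j].
  apply/seteqP; split=> [B oB i _ j _|B h]; first by rewrite /= oB.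
  by apply/matrixP => i j; exact: h.
apply: closed_bigI => i _; apply: closed_bigI => j _.
apply: (@preimage_closed _ _ (fun B : 'M[R]_n => (B^T *m B) i j)
  [set x | x = (1%:M : 'M[R]_n) i j]); last exact: closed_eq.
move=> B _; apply: (@cvg_coord _ (nbhs B)); apply: cvg_mulmx;
  last exact: cvg_id.
exact: trmx_continuous.
Qed.

Lemma orthogonal_mx_compact n : compact [set B : 'M[R]_n | orthogonal_mx B].
Proof.
apply: (subclosed_compact (@orthogonal_mx_closed n) (@compact_cube n n)).
move=> B oB i j; have := congr1 (fun M : 'M[R]_n => M j j) oB.
rewrite !mxE eqxx mulr1n (bigD1 i)//= !mxE => e.
have h : 0 <= \sum_(k < n | k != i) B^T j k * B k j.
  by apply: sumr_ge0 => k _; rewrite mxE -expr2 sqr_ge0.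
by rewrite -(@expr_le1 _ 2)// real_normK ?num_real//; rewrite expr2; lra.
Qed.

End MatrixTopology.

(** * Orthogonal matrices are conjugate to their transposes *)

Section TransposeConjugate.
Context {R : realType}.

Lemma mulmx_ext m n (A B : 'M[R]_(m, n)) :
  (forall x : 'cV[R]_n, A *m x = B *m x) -> A = B.
Proof.
move=> AB; apply/matrixP => i j; have := AB (delta_mx j ord0).
by rewrite -!colE => /colP/(_ i); rewrite !mxE.
Qed.

(* A maximizer of the quadratic form of [A + A^T] on the unit sphere of the
   image of [Q]. *)
Lemma orthoproj_eigenvector k (A Q : 'M[R]_k) :
  Q^T = Q -> Q *m Q = Q -> A *m Q = Q *m A -> Q != 0 ->
  exists v l, [/\ dotp v v = 1, Q *m v = v & (A + A^T) *m v = l *: v].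
Proof.
move=> QT QQ AQ Q0; set S := A + A^T.
have ST : S^T = S by rewrite /S linearD /= trmxK addrC.
have SQ : S *m Q = Q *m S.
  rewrite /S mulmxDl mulmxDr AQ; congr (_ + _).
  by rewrite -[LHS]trmxK trmx_mul trmxK QT -AQ trmx_mul QT.
pose K := [set v : 'cV[R]_k | dotp v v = 1 /\ Q *m v = v].
have normalize y : Q *m y = y -> y != 0 -> K ((enorm y)^-1 *: y).
  move=> Qy /enorm_gt0 y0; split; last by rewrite -scalemxAr Qy.
  by rewrite dotpZl dotpZr -enorm_sqr; field; rewrite gt_eqF.
have K0 : K !=set0.
  have [x Qx] : exists x : 'cV[R]_k, Q *m x != 0.
    apply: contra_neqP Q0 => h; apply: mulmx_ext => x; rewrite mul0mx.
    by apply/eqP/negPn/negP => h'; apply: h; exists x.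
  by eexists; apply: (normalize (Q *m x)) => //; rewrite mulmxA QQ.
have Kc : compact K.
  apply: (subclosed_compact _ (@compact_cube R k 1)); last first.
    by move=> v [v1 _] i j; rewrite ord1 (le_trans (coord_le_enorm v i))//
      /enorm v1 sqrtr1.
  have -> : K = (fun v : 'cV[R]_k => dotp v v) @^-1` [set x | x = 1] `&`
      (fun v : 'cV[R]_k => dotp (Q *m v - v) (Q *m v - v)) @^-1`
        [set x | x = 0].
    apply/seteqP; split=> v /= [v1 v2]; split=> //;
      first by rewrite v2 subrr dotp0l.
    by apply/eqP; rewrite -subr_eq0; apply/eqP/dotp_eq0.
  apply: closedI; apply: preimage_closed; try exact: closed_eq; move=> v _.
    by apply: (@cvg_dotp _ _ (nbhs v)); exact: cvg_id.
  have h : Q *m t - t @[t --> v] --> Q *m v - v.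
    by apply: (@cvgB _ _ _ (nbhs v));
      [exact: (@mulmx_continuous _ _ _ _ Q v)|exact: cvg_id].
  exact: (@cvg_dotp _ _ (nbhs v)).
have [|v /set_mem[v1 Qv] vmax] :=
    @compact_EVT_max _ R (fun v : 'cV[R]_k => dotp v (S *m v)) K K0 Kc.
  apply: continuous_subspaceT => v; apply: (@cvg_dotp _ _ (nbhs v));
    first exact: cvg_id.
  exact: (@mulmx_continuous _ _ _ _ S v).
set l := dotp v (S *m v) in vmax; exists v, l; split=> //.
(* Maximality of [l] makes the form of [N] nonnegative on the image of [Q], and it vanishes at [v].
   A null vector of a nonnegative form lies in its kernel, which is the eigenvector equation. *)
pose N := l%:M - S.
have NT : N^T = N by rewrite linearB /= ST tr_scalar_mx.
have Nge0 y : Q *m y = y -> 0 <= dotp y (N *m y).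
  move=> Qy; rewrite mulmxBl mul_scalar_mx dotpBr dotpZr.
  have [->|y0] := eqVneq y 0; first by rewrite !dotp0l; lra.
  have := vmax _ (mem_set (normalize y Qy y0)).
  rewrite -scalemxAr dotpZl dotpZr mulrA -invfM -expr2 enorm_sqr mulrC.
  by rewrite ler_pdivrMr -?enorm_sqr ?exprn_gt0 ?enorm_gt0//; lra.
have vNv : dotp v (N *m v) = 0.
  by rewrite mulmxBl mul_scalar_mx dotpBr dotpZr v1 mulr1 subrr.
have QNv : Q *m (N *m v) = N *m v.
  rewrite !(mulmxBl, mulmxBr) !mul_scalar_mx -scalemxAr.
  by rewrite mulmxA -SQ -mulmxA Qv.
suff : N *m v = 0.
  by rewrite mulmxBl mul_scalar_mx => /eqP; rewrite subr_eq0 => /eqP.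
set y := N *m v in QNv *; apply: dotp_eq0.
have b0 := Nge0 y QNv; set a := dotp y y; set b := dotp y (N *m y) in b0.
have a0 : 0 <= a by exact: dotp_ge0.
(* The form at [v + t *: y] equals [2 * t * a + t ^+ 2 * b]. The denominator is [b + 1] because [b]
   may vanish; with this [t] the value is [- t ^+ 2 * (b + 2)], so [t = 0] and [a = 0]. *)
have := Nge0 (v + (- a / (b + 1)) *: y); rewrite mulmxDr Qv -scalemxAr QNv.
move=> /(_ erefl); rewrite mulmxDr -scalemxAr -/y.
rewrite !(dotpDl, dotpDr) !(dotpZl, dotpZr) vNv -/a -/b.
have -> : dotp v (N *m y) = a by rewrite dotpC dotp_mulmxl NT.
set t := - a / (b + 1) => h.
have aE : a = - (t * (b + 1)) by rewrite /t divfK ?opprK// gt_eqF// ltr_wpDl.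
have t2 : t ^+ 2 * (b + 2) <= 0.
  by move: h; rewrite aE; set T := (X in 0 <= X -> _) => h;
    rewrite -[leLHS]opprK oppr_le0;
     rewrite (_ : - _ = T)// /T; ring.
have t0 : t = 0.
  apply/eqP; rewrite -sqrf_eq0 eq_le sqr_ge0 andbT -(@ler_pM2r _ (b
    + 2)) ?mul0r//.
  by rewrite ltr_wpDl.
by rewrite aE t0 mul0r oppr0.
Qed.

(* Induction on the rank of the invariant subspace, given by its orthogonal
   projection [Q]: an eigenvector [v] of [A + A^T] spans with [A v] an invariant
   plane (or line), on which the reflection fixing [v] conjugates [A] to [A^T].
   If [A v] is a multiple of [v], then [w = 0] and the junk value
   [d^-1 = 0] is harmless. *)
Lemma orthogonal_trmx_conj_on k (A : 'M[R]_k) : orthogonal_mx A ->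
  forall m (Q : 'M[R]_k), \tr Q <= m%:R ->
  Q^T = Q -> Q *m Q = Q -> A *m Q = Q *m A ->
  exists P : 'M[R]_k, [/\ P^T = P, P *m P = Q, Q *m P = P & P *m A = A^T *m P].
Proof.
move=> oA; elim=> [|m IH] Q trQ QT QQ AQ.
  suff -> : Q = 0 by exists 0; rewrite trmx0 !mul0mx mulmx0.
  apply/matrixP => i j; rewrite mxE.
  (* Since [Q] is [Q^T *m Q], its trace is the sum of the squared norms of its columns; trace at
     most zero thus forces [Q = 0]. *)
  have trE : \tr Q = \sum_j dotp (col j Q) (col j Q).
    apply: eq_bigr => l _; rewrite -[in LHS]QQ -[in X in X *m _]QT mxE.
    by apply: eq_bigr => h _; rewrite !mxE.
  move: trQ; rewrite trE => s0.
  have := @psumr_eq0 R 'I_k (index_enum _) xpredT (fun j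
    => dotp (col j Q) (col j Q)).
  rewrite -/(\sum_j _) => /(_ (fun _ _ => dotp_ge0 _)).
  have -> : \sum_j dotp (col j Q) (col j Q) == 0.
    by rewrite eq_le s0 sumr_ge0// => ? _; exact: dotp_ge0.
  move=> /esym/allP/(_ j (mem_index_enum _))/= /eqP/dotp_eq0/colP/(_ i).
  by rewrite !mxE.
have [Q0|Q0] := eqVneq Q 0.
  by exists 0; rewrite Q0 trmx0 !mul0mx mulmx0.
have [v [l [v1 Qv Sv]]] := orthoproj_eigenvector QT QQ AQ Q0.
(* The forms of [A] and [A^T] coincide at [v], so each contributes half of [l]; hence [w] is the
   part of [A *m v] orthogonal to [v]. *)
pose c := l / 2; have [w wE] : exists w, w = A *m v - c *: v by eexists.
pose d := dotp w w.
have Av : A *m v = c *: v + w by rewrite wE addrC subrK.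
have ATv : A^T *m v = c *: v - w.
  have -> : A^T *m v = l *: v - A *m v
    by rewrite -Sv mulmxDl addrAC subrr add0r.
  by rewrite Av opprD addrA -scalerBl; congr (_ *: _ + _); rewrite /c; field.
have vAv : dotp v (A *m v) = c.
  have : dotp v ((A + A^T) *m v) = l by rewrite Sv dotpZr v1 mulr1.
  by rewrite mulmxDl dotpDr -dotp_mulmxl (dotpC (A *m v)) /c; lra.
have vw : dotp v w = 0 by rewrite wE dotpBr dotpZr v1 vAv; lra.
have wv : dotp w v = 0 by rewrite dotpC.
have dE : d = 1 - c ^+ 2.
  have : dotp (A *m v) (A *m v) = 1 by rewrite dotp_mulmxl orthogonal_mxK.
  by rewrite Av !(dotpDl, dotpDr) !(dotpZl, dotpZr) v1 vw wv -/d; lra.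
have ATw : A^T *m w = d *: v + c *: w.
  rewrite {1}wE mulmxBr orthogonal_mxK// -scalemxAr ATv scalerBr opprB dE.
  by rewrite scalerBl scale1r scalerA -expr2 addrA [_ - _ as X in X = _]addrAC.
have Aw : A *m w = - d *: v + c *: w.
  rewrite (_ : w = c *: v - A^T *m v); last by rewrite ATv opprB addrC subrK.
  rewrite mulmxBr orthogonal_mxKV// -scalemxAr Av scalerDr scalerA ATv.
  rewrite opprB [w - _]addrC addrA subrr add0r dE opprB scalerBl scale1r expr2.
  by rewrite addrAC.
have Qw : Q *m w = w by rewrite wE mulmxBr -scalemxAr Qv mulmxA -AQ -mulmxA Qv.
have wd : d = 0 -> w = 0 by exact: dotp_eq0.
(* One family covers both operators: [E 1] is the orthogonal projection onto the span of [v] and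
   [w], and [E (-1)] fixes [v], reverses [w] and kills the orthogonal complement. Composition
   multiplies the parameters. *)
pose E s : 'M[R]_k := v *m v^T + (s / d) *: (w *m w^T).
have ET s : (E s)^T = E s by rewrite /E linearD linearZ /= !trmx_mul !trmxK.
have colrow (x y z : 'cV[R]_k) : x *m y^T *m z = dotp y z *: x.
  by rewrite -mulmxA [y^T *m z]mx11_scalar -dotpE mul_mx_scalar.
have Ex s x : E s *m x = dotp v x *: v + (s / d * dotp w x) *: w.
  by rewrite mulmxDl -scalemxAl !colrow scalerA.
have EE s t : E s *m E t = E (s * t).
  apply: mulmx_ext => x; rewrite -mulmxA !Ex !dotpDr !dotpZr v1 wv vw -/d.
  congr (_ *: _ + _); first by ring.
  have [/wd ->|d0] := eqVneq d 0; first by rewrite !scaler0.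
  by congr (_ *: _); field.
have QE s : Q *m E s = E s.
  by rewrite /E mulmxDr -scalemxAr !mulmxA Qv Qw.
have EQ s : E s *m Q = E s by rewrite -[LHS]trmxK trmx_mul ET QT QE.
have vA x : dotp v (A *m x) = c * dotp v x - dotp w x.
  by rewrite dotpC dotp_mulmxl ATv dotpBr dotpZr !(dotpC x).
have wA x : dotp w (A *m x) = d * dotp v x + c * dotp w x.
  by rewrite dotpC dotp_mulmxl ATw dotpDr !dotpZr !(dotpC x).
have AE : A *m E 1 = E 1 *m A.
  apply: mulmx_ext => x; rewrite -!mulmxA !Ex mulmxDr -!scalemxAr Av Aw vA wA.
  have [/wd w0|d0] := eqVneq d 0.
    by rewrite w0 dotp0l !mulr0 !scale0r !scaler0 !addr0 scalerA;
      congr (_ *: _); ring.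
  rewrite !scalerDr !scalerA addrACA -!scalerDl.
  by congr (_ *: _ + _ *: _); field.
have PA : E (-1) *m A = A^T *m E (-1).
  apply: mulmx_ext => x; rewrite -!mulmxA !Ex mulmxDr -!scalemxAr ATv ATw vA wA.
  have [/wd w0|d0] := eqVneq d 0.
    by rewrite w0 dotp0l !mulr0 !scale0r !scaler0 !subr0 !addr0 scalerA;
      congr (_ *: _); ring.
  rewrite !scalerBr !scalerDr !scalerA -scaleNr addrACA -!scalerDl.
  by congr (_ *: _ + _ *: _); field.
(* Removing [E 1] from [Q] lowers the trace by at least one, which is what the induction on [m]
   consumes. *)
have trE : 1 <= \tr (E 1).
  rewrite /E mxtraceD mxtraceZ [\tr (v *m _)]mxtrace_mulC
    [\tr (w *m _)]mxtrace_mulC.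
  rewrite !trace_mx11 -!dotpE v1 lerDl -/d; apply: mulr_ge0;
    last exact: dotp_ge0.
  by apply: divr_ge0 => //; exact: dotp_ge0.
clearbody E; have [||||P [PT PP QP PAA]] := IH (Q - E 1).
- by rewrite linearB /= lerBlDr; apply: le_trans trQ _; rewrite -natr1 lerD2l.
- by rewrite linearB /= QT ET.
- by rewrite mulmxBl !mulmxBr QQ QE EQ EE mulr1 subrr subr0.
- by rewrite mulmxBr mulmxBl AE AQ.
have EP s : E s *m P = 0.
  by rewrite -QP mulmxA mulmxBr EQ EE mulr1 subrr mul0mx.
have PE s : P *m E s = 0 by rewrite -[LHS]trmxK trmx_mul ET PT EP trmx0.
(* The reflection on the split-off span and the conjugator on its complement annihilate each other,
   so their sum squares to [Q]. *)
exists (E (-1) + P); split.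
- by rewrite linearD /= ET PT.
- rewrite mulmxDl !mulmxDr EE EP PE PP addr0 add0r mulrNN mulr1.
  by rewrite addrC subrK.
- rewrite mulmxDr QE; congr (_ + _).
  by rewrite -[in LHS]QP mulmxA mulmxBr QQ QE QP.
- by rewrite mulmxDl mulmxDr PA PAA.
Qed.

Lemma orthogonal_trmx_conj k (A : 'M[R]_k) : orthogonal_mx A ->
  exists P : 'M[R]_k, [/\ P^T = P, orthogonal_mx P & A^T = P *m A *m P].
Proof.
move=> oA; have [||||P [PT PP _ PA]] := orthogonal_trmx_conj_on oA (m :=
  k) (Q := 1%:M).
- by rewrite mxtrace1.
- exact: trmx1.
- exact: mulmx1.
- by rewrite mulmx1 mul1mx.
by exists P; split=> //; rewrite ?/orthogonal_mx ?PT// PA -mulmxA PP mulmx1.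
Qed.

(** * Invariance of the class of the restriction to the orthogonal of a vector *)

Lemma perp_class_sub_tr n (B : 'M[R]_n) v :
  orthogonal_mx B -> perp_class B v `<=` perp_class B^T v.
Proof.
move=> oB [k W] [/= E [[EE Ev] BE]].
have oW : orthogonal_mx W.
  rewrite /orthogonal_mx; have <- : (E *m W)^T *m (E *m W) = 1%:M.
    by rewrite -BE trmx_mul -mulmxA orthogonal_mxK.
  by rewrite trmx_mul -mulmxA (mulmxA E^T) EE mul1mx.
have BTE : B^T *m E = E *m W^T.
  rewrite -[in LHS](mulmx1 E) -(orthogonal_mxC oW) (mulmxA E) -BE.
  by rewrite -mulmxA orthogonal_mxK.
have [P [PT oP WT]] := orthogonal_trmx_conj oW.
have PP : P *m P = 1%:M by rewrite -[X in X *m _]PT.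
(* If [B] has matrix [W] in the basis [E], then [B^T] has matrix [W^T = P *m W *m P]; changing the
   basis by [P] turns it back into [W]. *)
exists (E *m P); split=> /=; last first.
  by rewrite mulmxA BTE WT -!mulmxA PP mulmx1.
split; first by rewrite trmx_mul PT -mulmxA (mulmxA E^T) EE mul1mx.
move=> w; rewrite Ev; split=> -[c ->].
  by exists (P *m c); rewrite -!mulmxA (mulmxA P) PP mul1mx.
by exists (P *m c); rewrite mulmxA.
Qed.

Lemma perp_class_tr n (B : 'M[R]_n) v :
  orthogonal_mx B -> perp_class B^T v = perp_class B v.
Proof.
move=> oB; apply/seteqP; split; last exact: perp_class_sub_tr.
by rewrite -[in X in _ `<=` X](trmxK B);
  exact/perp_class_sub_tr/orthogonal_mx_tr.
Qed.

Lemma perp_class_conj n (B C : 'M[R]_n) v : orthogonal_mx C ->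
  perp_class (C *m B *m C^T) (C *m v) = perp_class B v.
Proof.
have sub (B' C' : 'M[R]_n) v' : orthogonal_mx C' ->
    perp_class B' v' `<=` perp_class (C' *m B' *m C'^T) (C' *m v').
  move=> oC [k W] [/= E [[EE Ev] BE]]; exists (C' *m E); split=> /=; last first.
    by rewrite -!mulmxA orthogonal_mxK// BE.
  split; first by rewrite trmx_mul -mulmxA orthogonal_mxK.
  move=> w; rewrite dotp_mulmxl Ev; split=> -[c wE]; exists c.
    by rewrite -mulmxA -wE orthogonal_mxKV.
  by rewrite wE -mulmxA orthogonal_mxK.
move=> oC; apply/seteqP; split; last exact: sub.
have := sub (C *m B *m C^T) C^T (C *m v) (orthogonal_mx_tr oC).
by rewrite trmxK -!mulmxA oC mulmx1 !orthogonal_mxK.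
Qed.

End TransposeConjugate.

(** * Axes of an isometry *)

Lemma colv_coordE (R : realType) n :
  (forall (x y : 'cV[R]_n) i, (x + y) i ord0 = x i ord0 + y i ord0) *
  (forall (x : 'cV[R]_n) i, (- x) i ord0 = - x i ord0) *
  (forall a (x : 'cV[R]_n) i, (a *: x) i ord0 = a * x i ord0) *
  (forall i, (0 : 'cV[R]_n) i ord0 = 0).
Proof. by do !split=> *; rewrite mxE. Qed.

Ltac vring := apply/colP => ?; rewrite !colv_coordE; ring.

Section AxisTheory.
Context {R : realType} {n : nat}.
Implicit Types (B : 'M[R]_n) (b u v w x y : 'cV[R]_n).

Lemma fixed_spaceP B u : fixed_space B u <-> B *m u = u.
Proof.
by rewrite /fixed_space /= mulmxBl mul1mx; split=> [/eqP|->];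
  rewrite ?subrr// subr_eq0 => /eqP.
Qed.

Lemma fixed_space0 B : fixed_space B 0.
Proof. by apply/fixed_spaceP; rewrite mulmx0. Qed.

Lemma fixed_space_tr B u : orthogonal_mx B -> B *m u = u -> B^T *m u = u.
Proof. by move=> oB Bu; rewrite -[in LHS]Bu orthogonal_mxK. Qed.

Lemma fixed_perp_eq0 B u : fixed_space B u -> fixed_space_perp B u -> u = 0.
Proof. by move=> Fu /(_ u Fu); exact: dotp_eq0. Qed.

Lemma fixed_space_perpB B x y :
  fixed_space_perp B x -> fixed_space_perp B y -> fixed_space_perp B (x - y).
Proof. by move=> px py u Fu; rewrite dotpBr px// py// subrr. Qed.

Lemma image_fixed_space_perp B y :
  orthogonal_mx B -> fixed_space_perp B ((B - 1%:M) *m y).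
Proof.
move=> oB u /fixed_spaceP Bu; rewrite mulmxBl mul1mx dotpBr (dotpC u (B *m y)).
by rewrite dotp_mulmxl fixed_space_tr// dotpC subrr.
Qed.

(** The kernel and the image of [M = B - 1%:M] are orthogonal, so they meet trivially and [M *m M]
    has the rank of [M]. Hence [M *m b = M *m (M *m y)] is solvable, and [b - M *m y] is fixed. The
    transpose [N] serves to argue with row spaces. *)
Lemma fixed_space_decomp B b : orthogonal_mx B ->
  exists p y, fixed_space B p /\ b = p + (B - 1%:M) *m y.
Proof.
move=> oB; set M := B - 1%:M; pose N := M^T.
have rkN : \rank (N *m N) = \rank N.
  rewrite -[RHS](mxrank_mul_ker N N) (_ : \rank (_ :&: _)%MS = 0%N) ?addn0//.
  apply/eqP; rewrite mxrank_eq0; apply/eqP/row_matrixP => i; rewrite row0.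
  have := row_sub i (N :&: kermx N)%MS;
    rewrite sub_capmx => /andP[/submxP[z ->]].
  move=> /sub_kermxP zNN; have := congr1 trmx zNN;
    rewrite -mulmxA !trmx_mul trmxK.
  rewrite trmx0 -mulmxA => MMz; apply: trmx_inj; rewrite trmx_mul trmxK trmx0.
  by apply: (fixed_perp_eq0 (B := B)); [|exact: image_fixed_space_perp].
have /submxP[z bz] : (b^T *m N <= N *m N)%MS.
  rewrite (submx_trans (submxMl _ _))//.
  by have [_ /esym] := mxrank_leqif_sup (submxMl N N); rewrite rkN eqxx.
have Mb : M *m b = M *m (M *m z^T).
  by apply: trmx_inj; rewrite trmx_mul bz !trmx_mul trmxK mulmxA.
exists (b - M *m z^T), z^T; split; last by rewrite subrK.
by rewrite /fixed_space /= mulmxBr Mb subrr.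
Qed.

Lemma bplusP B b : orthogonal_mx B ->
  fixed_space B (bplus B b) /\ fixed_space_perp B (b - bplus B b).
Proof.
move=> oB; have [p [y [Fp bE]]] := fixed_space_decomp b oB.
have h : [set p | fixed_space B p /\ fixed_space_perp B (b - p)] p.
  by split=> //; rewrite bE addrC addKr; exact: image_fixed_space_perp.
exact: (xgetPex 0 (ex_intro _ p h)).
Qed.

Lemma bplus_unique B b p : orthogonal_mx B ->
  fixed_space B p -> fixed_space_perp B (b - p) -> bplus B b = p.
Proof.
move=> oB Fp pp; have [Fb pb] := bplusP b oB.
apply/eqP; rewrite -subr_eq0; apply/eqP/(fixed_perp_eq0 (B := B)).
  by rewrite /fixed_space /= mulmxBr Fb Fp subrr.
have -> : bplus B b - p = (b - p) - (b - bplus B b).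
  by vring.
exact: fixed_space_perpB.
Qed.

(** Write [bprime B b] as [(B - 1%:M) *m y]. Since [B] commutes with [B - 1%:M], the vector
    [- (B *m y)] solves the equation; discarding its fixed part brings it into the orthogonal of the
    fixed space. *)
Lemma axis_originP B b : orthogonal_mx B ->
  (B - 1%:M) *m axis_origin B b = - (B *m bprime B b).
Proof.
move=> oB; have [Fb pb] := bplusP b oB.
have [p [y [Fp bE]]] := fixed_space_decomp b oB.
have b'E : bprime B b = (B - 1%:M) *m y.
  rewrite /bprime {1}bE (_ : bplus B b = p); first by rewrite addrC addKr.
  by apply: bplus_unique => //; rewrite bE addrC addKr;
    exact: image_fixed_space_perp.
have [q [z [Fq yE]]] := fixed_space_decomp (- (B *m y)) oB.
have h : [set o | fixed_space_perp B o /\ (B - 1%:M) *m o = - (B *m bprime B b)]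
    ((B - 1%:M) *m z).
  split; first exact: image_fixed_space_perp.
  transitivity ((B - 1%:M) *m (- (B *m y)));
    first by rewrite yE mulmxDr Fq add0r.
  by rewrite mulmxN b'E !mulmxA mulmxBl mulmxBr mul1mx mulmx1.
by have [] := xgetPex 0 (ex_intro _ _ h).
Qed.

Lemma axisE B b u t : axis B b u t = axis B b u 0 + t *: bplus B b.
Proof. by rewrite /axis scale0r addr0. Qed.

Lemma BL_axis B b u t : orthogonal_mx B -> fixed_space B u ->
  BL B b (axis B b u t) = axis B b u (t + 1).
Proof.
move=> oB /fixed_spaceP Bu; have [/fixed_spaceP Fb _] := bplusP b oB.
have := axis_originP b oB; rewrite mulmxBl mul1mx => oE.
rewrite /BL /axis !mulmxDr -scalemxAr Bu Fb -[B *m axis_origin B b](subrK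
  (axis_origin B b)).
by rewrite oE /bprime mulmxBr Fb; vring.
Qed.

(** Applying [B^T] to [B *m (x + b - v) = x] puts [b - v] in the image of [B - 1%:M], which is
    orthogonal to the fixed vectors; so [v] is the fixed component of [b]. The offset is
    [u = x - axis_origin B b]. *)
Lemma axis_of_translated_line B b x v : orthogonal_mx B ->
  B *m v = v -> BL B b x = x + v ->
  bplus B b = v /\ exists2 u, fixed_space B u & axis B b u = fun t
    => x + t *: v.
Proof.
move=> oB Bv gx; have /fixed_spaceP Fv := Bv.
have bE : b - v = (B - 1%:M) *m (- (B^T *m x)).
  have : B *m (x + b - v) = x by rewrite mulmxBr Bv -/(BL B b x) gx addrK.
  move=> /(congr1 (mulmx B^T)); rewrite orthogonal_mxK// => <-.
  rewrite mulmxBl mul1mx mulmxN !mulmxBr mulmxDr Bv.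
  by move: gx; rewrite /BL mulmxDr => ->; vring.
have bv : bplus B b = v.
  by apply: bplus_unique => //; rewrite bE; exact: image_fixed_space_perp.
split=> //; exists (x - axis_origin B b).
  rewrite /fixed_space /= mulmxBr axis_originP// opprK /bprime bv mulmxBr Bv.
  rewrite mulmxBl mul1mx; move: gx; rewrite /BL mulmxDr => gx.
  by rewrite -[B *m x](addrK (B *m b)) gx; vring.
by apply/funext => t; rewrite /axis bv; vring.
Qed.

End AxisTheory.

(** * Discrete groups of isometries *)

Section DiscreteGroup.
Context {R : realType} {n : nat} (Gamma : isom_group R n).
Local Notation V := 'cV[R]_n.
Implicit Types (g h : V -> V) (x y : V).

Lemma isom_groupP g : Gamma g -> exists B b, orthogonal_mx B /\ g = BL B b.
Proof. by move/isom_setP/isometryP. Qed.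

Lemma isom_group_continuous g : Gamma g -> continuous g.
Proof. by move=> /isom_groupP[B [b [_ ->]]]; exact: BL_continuous. Qed.

Lemma isom_group_iter g k : Gamma g -> Gamma (iter k g).
Proof.
move=> Gg; elim: k => [|k IH]; first exact: isom_id.
by rewrite (_ : iter k.+1 g = g \o iter k g)//; exact: isom_comp.
Qed.

(* A cluster point [C] of the linear parts makes the quotients [g_i^-1 g_j]
   arbitrarily close to the identity, hence equal to it. *)
Lemma discrete_recurrent x (g : nat -> V -> V) : discrete_isom_group Gamma ->
  (forall k, Gamma (g k)) -> enorm (g k x - x) @[k --> \oo] --> (0 : R) ->
  exists i0, forall N, exists2 i, (N <= i)%N & g i = g i0.
Proof.
move=> disc Gg gx.
have /choice[Bb gE] k : exists p : 'M[R]_n * V, orthogonal_mx p.1 /\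
    g k = BL p.1 p.2.
  by have [B [b [oB ->]]] := isom_groupP (Gg k); exists (B, b).
have [C [oC clC]] : [set B : 'M[R]_n | orthogonal_mx B] `&`
    cluster ((fun k => (Bb k).1) @ \oo) !=set0.
  by apply: orthogonal_mx_compact; exists 0%N => // k _; have [] := gE k.
(* Each isometry is recorded by its linear part and its displacement at [x]; [phi] then gives the
   coefficients, in the form [BL], of the inverse of the first composed with the second. *)
pose phi (q : ('M[R]_n * V) * ('M[R]_n * V)) : 'M[R]_n * V :=
  (q.1.1^T *m q.2.1,
   (q.1.1^T *m q.2.1)^T *m (q.1.1^T *m (q.2.2 - q.1.2) + x) - x).
have phiC : phi @ ((C, 0 : V), (C, 0 : V)) --> ((1%:M : 'M[R]_n), (0 : V)).
  pose F := nbhs ((C, 0 : V), (C, 0 : V)).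
  have FF : Filter F by exact: filter_prod_filter.
  have c11 : q.1.1 @[q --> F] --> C.
    exact: (cvg_comp _ _ cvg_fst cvg_fst).
  have c12 : q.1.2 @[q --> F] --> (0 : V).
    exact: (cvg_comp _ _ cvg_fst cvg_snd).
  have c21 : q.2.1 @[q --> F] --> C.
    exact: (cvg_comp _ _ cvg_snd cvg_fst).
  have c22 : q.2.2 @[q --> F] --> (0 : V).
    exact: (cvg_comp _ _ cvg_snd cvg_snd).
  have cC : q.1.1^T *m q.2.1 @[q --> F] --> C^T *m C.
    exact: (cvg_mulmx (cvg_trmx c11) c21).
  have cV : (q.1.1^T *m q.2.1)^T *m (q.1.1^T *m (q.2.2 - q.1.2) + x) - x
      @[q --> F] --> (C^T *m C)^T *m (C^T *m (0 - 0) + x) - x.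
    have c1 : q.1.1^T *m (q.2.2 - q.1.2) + x @[q --> F] --> C^T *m (0 - 0) + x.
      exact: (cvgD (cvg_mulmx (cvg_trmx c11) (cvgB c22 c12)) (cvg_cst x)).
    exact: (cvgB (cvg_mulmx (cvg_trmx cC) c1) (cvg_cst x)).
  rewrite oC in cC.
  rewrite oC trmx1 mul1mx subrr mulmx0 add0r subrr in cV.
  exact: (cvg_pair cC cV).
have G1 : Gamma (BL 1%:M 0).
  rewrite (_ : BL _ _ = id); first exact: isom_id.
  by apply/funext => y; rewrite /BL mul1mx addr0.
have := phiC _ (disc _ _ G1) => -[[P Q] /= [PC QC] PQ].
have [[U1 T1] /= [CU1 /nbhs_enorm[e1 e1_gt0 eT1]] UTP] := PC.
have [[U2 T2] /= [CU2 /nbhs_enorm[e2 e2_gt0 eT2]] UTQ] := QC.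
have small e : 0 < e -> exists N, forall k, (N <= k)%N -> enorm (g k x - x) < e.
  move=> e0; have [N _ hN] : \forall k \near \oo, enorm (g k x - x) < e.
    by move/cvgr_lt: gx; exact.
  by exists N.
have far N e U : 0 < e -> nbhs C U ->
    exists i, [/\ (N <= i)%N, U (Bb i).1 & enorm (g i x - x - 0) < e].
  move=> /small[M hM] CU.
  have := clC [set B | exists2 k, (maxn M N <= k)%N & B = (Bb k).1] U.
  move=> [||B [[k Mk ->] Uk]] //; first by exists (maxn M N) => // k /= ?;
    exists k.
  move: Mk; rewrite geq_max => /andP[Mk Nk].
  by exists k; split=> //; rewrite subr0; exact: hM.
(* The neighbourhood obtained from [phiC] is a product, so [i0] can be fixed from its first factor
   before [N] is given. *)
have [i0 [_ Ui0 ti0]] := far 0%N e1 U1 e1_gt0 CU1.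
exists i0 => N; have [i [Ni Ui ti]] := far N e2 U2 e2_gt0 CU2.
exists i => //.
have [oB1 g1E] := gE i0; have [oB2 g2E] := gE i.
pose B1 := (Bb i0).1; pose B2 := (Bb i).1.
have [h Gh [gh hg]] := isom_inv (Gg i0).
have oBh : orthogonal_mx (B1^T *m B2).
  by apply: orthogonal_mxM => //; exact: orthogonal_mx_tr.
have hE : h \o g i = BL (B1^T *m B2) ((B1^T *m B2)^T *m
    (B1^T *m ((g i x - x) - (g i0 x - x)) + x) - x).
  have g1x z : g i0 z = g i0 x + B1 *m (z - x).
    by rewrite -[in LHS](subrK x z) addrC g1E BLD.
  have g2x z : g i z = g i x + B2 *m (z - x).
    by rewrite -[in LHS](subrK x z) addrC g2E BLD.
  apply/funext => y; rewrite /=; apply: (can_inj gh); rewrite hg g1x g2x.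
  have -> t : BL (B1^T *m B2) ((B1^T *m B2)^T *m t - x) y = B1^T *m B2 *m (y -
    x) + t.
    rewrite /BL (_ : y + _ = (B1^T *m B2)^T *m t + (y - x)); last by vring.
    by rewrite mulmxDr orthogonal_mxKV// addrC.
  by rewrite addrA addrK (mulmxDr B1) -mulmxA !orthogonal_mxKV//; vring.
have P1 : P (B1, g i0 x - x) by apply: UTP; split=> //=; exact: eT1.
have Q2 : Q (B2, g i x - x) by apply: UTQ; split=> //=; exact: eT2.
have := PQ (_, _) (conj P1 Q2);
  rewrite /phi /= -hE => /(_ (isom_comp Gh (Gg i))).
move=> -[h1 h2]; move: hE; rewrite h2 h1 => hE.
apply/funext => y; rewrite -[LHS]hg -[h (g i y)]/((h \o g i) y) hE /BL.
by rewrite mul1mx addr0.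
Qed.

(** All powers of [g] fix [x], so recurrence makes two of them equal at distinct exponents; [g] then
    has finite order. *)
Lemma discrete_free g x : discrete_isom_group Gamma -> torsion_free Gamma ->
  Gamma g -> g x = x -> g = id.
Proof.
move=> disc tf Gg gx; have gkx k : iter k g x = x.
  by elim: k => //= k ->.
have [||i0 hi] := @discrete_recurrent x (fun k => iter k g) disc.
- by move=> k; exact: isom_group_iter.
- by under eq_cvg do rewrite gkx subrr enorm0; exact: cvg_cst.
have [i ii0 gi] := hi i0.+1; apply/funext; apply: (tf g (i - i0.+1)%N) => // y.
have [h Gh [gh hg]] := isom_inv (isom_group_iter i0 Gg).
apply: (can_inj gh); rewrite -[LHS]iterD addnS -addSn subnKC//.
exact: (congr1 (@^~ y) gi).
Qed.

(** Otherwise some elements have nonzero displacements at [x] tending to zero; by recurrence one of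
    these displacements is taken infinitely often, contradicting the limit. *)
Lemma discrete_proper x : discrete_isom_group Gamma ->
  exists2 e, 0 < e & forall g, Gamma g -> enorm (g x - x) < e -> g x = x.
Proof.
move=> disc; apply: contrapT => noe.
have /choice[g gP] (k : nat) : exists g : V -> V,
    [/\ Gamma g, enorm (g x - x) < k.+1%:R^-1 & g x != x].
  apply: contrapT => nog; apply: noe; exists k.+1%:R^-1 => // g Gg gx.
  by apply/eqP/negPn/negP => gxx; apply: nog; exists g.
have [||i0 hi] := @discrete_recurrent x g disc.
- by move=> k; have [] := gP k.
- apply: (@squeeze_cvgr _ _ _ _ (fun=> 0) (fun k => k.+1%:R^-1)).
  + by near=> k; have [_ /ltW -> _] := gP k; rewrite enorm_ge0.
  + exact: cvg_cst.
  + exact: cvg_harmonic.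
have [_ _] := gP i0; rewrite -subr_eq0 => /enorm_gt0 d0.
have := cvg_harmonic (R := R) => /cvgr_lt/(_ _ d0)[N _ hN].
have [i Ni gi] := hi N; have [_] := gP i; rewrite gi => lt1 _.
by have := lt_trans lt1 (hN i Ni); rewrite ltxx.
Unshelve. all: by end_near. Qed.

End DiscreteGroup.

(** * Lifts *)

(** Continuation principle: the truth set and its complement are both open in a connected space. *)
Lemma locally_constant_R (R : realType) (P : R -> Prop) :
  (forall t, \forall s \near t, P s <-> P t) -> forall s t, P s -> P t.
Proof.
move=> lc s t Ps; suff -> : P = setT by [].
have : connected [set: R] by apply/connected_intervalP => ? ? ? ?.
apply; first by exists s.
- exists P; last by rewrite setTI.
  by rewrite openE => x Px; apply: filterS (lc x) => y ->.
- exists P; last by rewrite setTI.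
  move=> x clx; have [y [Py]] := clx _ (lc x).
  by move=> /= <-.
Qed.

Section Lifts.
Context {R : realType} {n : nat} (Gamma : isom_group R n).
Context (disc : discrete_isom_group Gamma) (tf : torsion_free Gamma).
Local Notation V := 'cV[R]_n.
Local Notation prj := (orbit_proj Gamma).
Implicit Types (g h : V -> V) (x y : V).

Lemma orbit_projP x y : prj x = prj y <-> exists2 g, Gamma g & g x = y.
Proof.
have := @eqmodP _ (orbit_equiv Gamma) x y; rewrite /= /orbit_rel => eqP.
by split=> [/eqP/asboolP|?]; last exact/eqP/asboolP.
Qed.

Lemma tangent_projP x v y w :
  tangent_proj Gamma x v = tangent_proj Gamma y w <->
  exists2 g, Gamma g & g x = y /\ g (x + v) - g x = w.
Proof.
have := @eqmodP _ (tangent_equiv Gamma) (x, v) (y, w);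
  rewrite /= /tangent_rel => eqP.
split=> [/eqP/asboolP[g Gg [gx gv]]|[g Gg [gx gv]]]; first by exists g.
by apply/eqP/asboolP; exists g; rewrite //= gv gx.
Qed.

Lemma orbit_proj_continuous : continuous prj.
Proof. exact: pi_continuous. Qed.

Lemma orbit_proj_isom g x : Gamma g -> prj (g x) = prj x.
Proof. by move=> Gg; apply/esym/orbit_projP; exists g. Qed.

Lemma free_action g h x : Gamma g -> Gamma h -> g x = h x -> g = h.
Proof.
move=> Gg Gh gh; have [k Gk [hk kh]] := isom_inv Gh.
have kg : k \o g = id.
  by apply: (discrete_free (Gamma := Gamma) (x := x)) => //;
    [exact: isom_comp|rewrite /= gh hk].
by apply/funext => y; rewrite -[LHS]kh -[k (g y)]/((k \o g) y) kg.
Qed.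

Lemma free_radius x :
  exists2 e, 0 < e & forall g, Gamma g -> enorm (g x - x) < e -> g = id.
Proof.
have [e e0 he] := discrete_proper x disc; exists e => // g Gg gx.
by apply: (discrete_free (Gamma := Gamma) (x := x)) => //; exact: he.
Qed.

Lemma orbit_proj_locally_inj x : exists2 e, 0 < e & forall y y',
  enorm (y - x) < e -> enorm (y' - x) < e -> prj y = prj y' -> y = y'.
Proof.
have [e e0 he] := free_radius x; exists (e / 2); first by rewrite divr_gt0.
move=> y y' yx y'x /orbit_projP[g Gg gy]; rewrite -gy (he g)//.
have := enorm_dist (g y) (g x) x; rewrite (isom_setP Gg) gy (enormBC x y); lra.
Qed.

Lemma lift_germ T (F : set_system T) {FF : Filter F} (c c' : T -> V) g x :
  Gamma g -> c @ F --> x -> c' @ F --> g x ->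
  (\forall t \near F, prj (c t) = prj (c' t)) ->
    \forall t \near F, g (c t) = c' t.
Proof.
move=> Gg cx cgx cc'; have [e e0 he] := orbit_proj_locally_inj (g x).
have gc : g (c t) @[t --> F] --> g x.
  exact: (cvg_comp _ _ cx (@isom_group_continuous _ _ Gamma _ Gg x)).
have n1 : \forall t \near F, enorm (g (c t) - g x) < e
  by exact: near_enorm_comp.
have n2 : \forall t \near F, enorm (c' t - g x) < e by exact: near_enorm_comp.
near=> t; apply: he; [by near: t|by near: t|].
by rewrite orbit_proj_isom//; near: t.
Unshelve. all: by end_near. Qed.

(** Agreement spreads to a neighbourhood by [lift_germ]; disagreement does so because the distance
    between the two lifts is continuous. *)
Lemma lift_unique (c c' : R -> V) g t0 : continuous c -> continuous c' ->
  Gamma g -> (forall t, prj (c t) = prj (c' t)) -> g (c t0) = c' t0 ->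
  forall t, g (c t) = c' t.
Proof.
move=> cc cc' Gg pcc' gt0 t;
  apply: (@locally_constant_R _ (fun t => g (c t) = c' t)) gt0.
move=> s; have [e|ne] := pselect (g (c s) = c' s).
  have cs : c' t @[t --> s] --> g (c s) by rewrite e; exact: cc'.
  have := lift_germ (FF := nbhs_filter s) Gg (cc s) cs.
  by move=> /(_ (filterE _ pcc')); apply: filterS => r ->.
have d0 : 0 < enorm (g (c s) - c' s).
  by apply: enorm_gt0; rewrite subr_eq0; exact/eqP.
have cd : enorm (g (c t) - c' t) @[t --> s] --> enorm (g (c s) - c' s).
  apply: (@cvg_enorm _ _ (nbhs s)); apply: cvgB; last exact: cc'.
  exact: (cvg_comp _ _ (cc s) (@isom_group_continuous _ _ Gamma _ Gg (c s))).
move/cvgr_gt: cd => /(_ _ d0); apply: filterS => r dr; split=> // e.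
by move: dr; rewrite e subrr enorm0 ltxx.
Qed.

(** The orbit projection is open: the preimage of the image of a ball is the union of the translates
    of that ball. *)
Lemma near_lift x e : 0 < e ->
  \forall p \near prj x, exists2 y, prj y = p & enorm (y - x) < e.
Proof.
move=> e0; pose U := [set p | exists2 y, prj y = p & enorm (y - x) < e].
apply: (@open_nbhs_nbhs _ _ U); split; last by exists x; rewrite ?subrr ?enorm0.
rewrite /open /= /quotient_open.
rewrite openE => z [y /esym/orbit_projP[g Gg gz] yx].
have d0 : 0 < e - enorm (y - x) by rewrite subr_gt0.
apply: filterS (near_enorm z d0) => w wz; exists (g w);
  first exact: orbit_proj_isom.
have := enorm_dist (g z) (g w) x; rewrite (isom_setP Gg) gz; lra.
Qed.

(** A radius at [x0] yields one for all orbits passing near [x0]: conjugation moves [x] to a point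
    [y] within a third of the radius from [x0], and the triangle inequality uses that distance twice
    and the displacement once. Compactness of the quotient makes the choice uniform. *)
Lemma uniform_free_radius : compact [set: flat_manifold Gamma] ->
  exists2 e, 0 < e & forall x g, Gamma g -> enorm (g x - x) < e -> g = id.
Proof.
move/compact_near_coveringP => /(_ R 0^'+ (fun e p =>
  forall x g, prj x = p -> Gamma g -> enorm (g x - x) < e -> g = id)).
move=> /(_ _)[].
  move=> p _; rewrite -[p]reprK; set x0 := repr p.
  have [e0 e0_gt0 he0] := free_radius x0.
  have e3 : 0 < e0 / 3 by rewrite divr_gt0.
  near=> p' e => x g xp' Gg gx.
  have [y yp' yx0] : exists2 y, prj y = p' & enorm (y - x0) < e0 / 3.
    by near: p'; exact: near_lift.
  have ee : e < e0 / 3 by near: e; exact: nbhs_right_lt.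
  have [k Gk ky] : exists2 k, Gamma k & k y = x.
    by apply/orbit_projP; rewrite yp'.
  have [k' Gk' [kk' k'k]] := isom_inv Gk.
  have Gc : Gamma (k' \o g \o k) by apply: isom_comp => //; exact: isom_comp.
  have : k' \o g \o k = id.
    apply: he0 => //.
    have h1 : enorm ((k' \o g \o k) x0 - (k' \o g \o k) y) = enorm (y - x0).
      by rewrite (isom_setP Gc) enormBC.
    have h2 : enorm ((k' \o g \o k) y - y) < e.
      by rewrite -{2}(kk' y) /= (isom_setP Gk') ky.
    have := enorm_dist ((k' \o g \o k) y) ((k' \o g \o k) x0) x0.
    have := enorm_dist y ((k' \o g \o k) y) x0.
    lra.
  move=> kgk; apply/funext => z; rewrite -[LHS]k'k -[z in LHS]k'k.
  by rewrite -[k' _]/((k' \o g \o k) (k' z)) kgk /= k'k.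
move=> e /= e0 he; exists (e / 2); first by rewrite divr_gt0.
move=> x g Gg gx; apply: (he (e / 2) _ _ (prj x) I x g) => //=;
  last by rewrite divr_gt0.
by rewrite sub0r normrN gtr0_norm ?divr_gt0// ltr_pdivrMr// mulr_natr mulr2n
  ltrDl.
Unshelve. all: by end_near. Qed.

End Lifts.

(** * Free homotopy classes *)

(** Retraction onto the unit segment. It extends a homotopy, continuous only within the strip, to
    the whole plane, so that the parameter runs over the connected real line. *)
Definition clamp01 (R : realType) (s : R) : R := Num.max 0 (Num.min 1 s).

Lemma clamp01_itv (R : realType) (s : R) : clamp01 s \in `[0%R, 1%R].
Proof. by rewrite in_itv /= /clamp01 le_max lexx /= ge_max ler01 ge_min lexx.
  Qed.

Lemma clamp010 (R : realType) : clamp01 (0 : R) = 0.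
Proof. by rewrite /clamp01 min_r ?ler01// maxxx. Qed.

Lemma clamp011 (R : realType) : clamp01 (1 : R) = 1.
Proof. by rewrite /clamp01 minxx max_r// ler01. Qed.

Lemma clamp01_continuous (R : realType) : continuous (@clamp01 R).
Proof.
move=> s; apply: (@continuous_max _ _ (fun=> 0) (fun s : R => Num.min 1 s) s);
  first exact: cvg_cst.
by apply: (@continuous_min _ _ (fun=> 1) id s); [exact: cvg_cst|exact: cvg_id].
Qed.

Lemma periodic1_itv (R : realType) T (f : R -> T) : (forall t, f (t
  + 1) = f t) ->
  forall t, f t = f (t - (Num.floor t)%:~R).
Proof.
move=> f1; have fn (k : nat) t : f (t + k%:R) = f t.
  by elim: k => [|k IH]; rewrite ?addr0// -natr1 addrA f1.
move=> t; case: (Num.floor t) => k; last by rewrite NegzE mulrNz opprK fn.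
by rewrite -[in LHS](subrK k%:R t) fn.
Qed.

Section FreeHomotopy.
Context {R : realType} {n : nat} (Gamma : isom_group R n).
Context (disc : discrete_isom_group Gamma) (tf : torsion_free Gamma).
Local Notation V := 'cV[R]_n.
Local Notation prj := (orbit_proj Gamma).
Implicit Types (g h : V -> V) (x y : V) (alpha beta : R -> flat_manifold Gamma).

(** A relation rather than a function of [alpha]: the element depends on the lift, and for [g] in
    [Gamma] every conjugate of [g] is related to the same path. *)
Definition has_deck alpha g := exists2 c : R -> V, continuous c &
  (forall t, alpha t = prj (c t)) /\ (forall t, c (t + 1) = g (c t)).

Lemma has_deck_conj alpha g h k : Gamma k -> k \o g = h \o k ->
  has_deck alpha g -> has_deck alpha h.
Proof.
move=> Gk kgh [c cc [ac cg]]; exists (k \o c); last split.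
- by move=> t; exact: (cvg_comp _ _ (cc t) (@isom_group_continuous _ _ Gamma _
    Gk (c t))).
- by move=> t; rewrite ac /= orbit_proj_isom.
- by move=> t; rewrite /= cg; exact: (congr1 (@^~ (c t)) kgh).
Qed.

(** The element taking one lift to the other at time 0 does so at all times; comparison one period
    later gives the conjugacy. *)
Lemma has_deck_conjugate alpha g h : Gamma g -> Gamma h ->
  has_deck alpha g -> has_deck alpha h -> conjugate_in Gamma g h.
Proof.
move=> Gg Gh [c cc [ac cg]] [c' cc' [ac' c'h]].
have [k Gk kc] : exists2 k, Gamma k & k (c 0) = c' 0.
  by apply/orbit_projP; rewrite -ac -ac'.
have kct t : k (c t) = c' t.
  by apply: (lift_unique disc tf (c := c) (c' := c') (t0 := 0)) => // s;
    rewrite -ac -ac'.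
exists k => //; apply: (free_action (x := c 0) disc tf); try exact: isom_comp.
by rewrite /= -cg kc -c'h kct.
Qed.

(* The elements of [Gamma] are affine, so the straight-line homotopy between
   the lifts descends. *)
Lemma has_deck_homotopic alpha beta g : Gamma g ->
  has_deck alpha g -> has_deck beta g -> freely_homotopic alpha beta.
Proof.
move=> Gg; have [B [b [oB gE]]] := isom_groupP Gg;
  move=> [c cc [ac cg]] [c' cc' [bc' c'g]].
exists (fun p => prj ((1 - p.1) *: c p.2 + p.1 *: c' p.2)); split.
- apply: continuous_subspaceT => p.
  have p1 : q.1 @[q --> p] --> p.1 by exact: cvg_fst.
  have p2 : q.2 @[q --> p] --> p.2 by exact: cvg_snd.
  apply: (@continuous_comp _ _ _ (fun p : R * R
    => (1 - p.1) *: c p.2 + p.1 *: c' p.2) prj);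
    last exact: orbit_proj_continuous.
  apply: (@cvgD _ _ _ (nbhs p)); apply: cvgZ.
  + by apply: cvgB; [exact: cvg_cst|].
  + exact: (cvg_comp _ _ p2 (cc p.2)).
  + by [].
  + exact: (cvg_comp _ _ p2 (cc' p.2)).
- move=> s t _ /=; rewrite cg c'g; apply/esym/orbit_projP; exists g => //.
  rewrite gE /BL !mulmxDr -!scalemxAr; set x := B *m c t; set y := B *m c' t.
  set z := B *m b; vring.
- by move=> t; rewrite /= subr0 scale1r scale0r addr0 ac.
- by move=> t; rewrite /= subrr scale0r scale1r add0r bc'.
Qed.

(** * Persistence of the closing element under deformation *)

Definition proj_close e (p q : flat_manifold Gamma) :=
  exists x y, [/\ prj x = p, prj y = q & enorm (x - y) < e].

Lemma proj_closeC e p q : proj_close e p q -> proj_close e q p.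
Proof. by move=> [x [y [xp yq xy]]]; exists y, x; rewrite enormBC. Qed.

Lemma proj_close_lift e x q : proj_close e (prj x) q ->
  exists2 y, prj y = q & enorm (y - x) < e.
Proof.
move=> [x' [y [/orbit_projP[g Gg <-] yq xy]]]; exists (g y).
  by rewrite orbit_proj_isom.
by rewrite (isom_setP Gg) enormBC.
Qed.

(* The lift of [beta] is the one that stays close to the lift of [alpha]. *)
Lemma has_deck_close e alpha beta g :
  (forall x h, Gamma h -> enorm (h x - x) < e -> h = id) -> 0 < e ->
  continuous beta -> (forall t, beta (t + 1) = beta t) -> Gamma g ->
  (forall t, proj_close (e / 4) (alpha t) (beta t)) ->
  has_deck alpha g -> has_deck beta g.
Proof.
move=> rad e0 cb b1 Gg close [c cc [ac cg]].
(* Points of one orbit at distance less than [e] coincide. Comparing two candidate lifts passes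
   through [c' t0], [c t0] and [c t], hence at most four steps of length [e / 4]. *)
have d0 : 0 < e / 4 by rewrite divr_gt0.
have /choice[c' c'P] t : exists y, prj y = beta t /\ enorm (y - c t) < e / 4.
  have := close t; rewrite ac => /proj_close_lift[y yb yc].
  by exists y.
have inj y y' : prj y = prj y' -> enorm (y - y') < e -> y = y'.
  by move=> /orbit_projP[h Gh <-] yy'; rewrite (rad y h)// enormBC.
exists c'; last split.
- move=> t0; apply: (@cvg_enormP _ _ (nbhs t0)) => d d_gt0.
  have m0 : 0 < Num.min d (e / 4) by rewrite lt_min d_gt0.
  have [bt0 ct0] := c'P t0.
  have n1 : \forall t \near t0,
      exists2 y, prj y = beta t & enorm (y - c' t0) < Num.min d (e / 4).
    have cb0 : beta @ t0 --> prj (c' t0) by rewrite bt0; exact: cb.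
    exact: (cb0 _ (near_lift Gamma _ m0)).
  have n2 : \forall t \near t0, enorm (c t - c t0) < e / 4.
    by apply: (@near_enorm_comp _ _ (nbhs t0)) => //; exact: cc.
  near=> t; have [y yb yc] : exists2 y, prj y = beta t & enorm (y - c' t0) <
    Num.min d (e / 4).
    by near: t.
  have ctt : enorm (c t - c t0) < e / 4 by near: t.
  have [bt ct] := c'P t; move: yc; rewrite lt_min => /andP[yd ye].
  suff <- : y = c' t by [].
  apply: inj; first by rewrite yb.
  have := enorm_dist (c' t0) y (c' t); have := enorm_dist (c t0) (c' t0) (c' t).
  have := enorm_dist (c t) (c t0) (c' t).
  rewrite (enormBC (c t0) (c t)) (enormBC (c t) (c' t)); lra.
- by move=> t; have [] := c'P t.
- move=> t; have [bt ct] := c'P t; have [bt1 ct1] := c'P (t + 1).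
  apply: inj; first by rewrite orbit_proj_isom// bt bt1.
  have h2 : enorm (c (t + 1) - g (c' t)) < e / 4.
    by rewrite cg (isom_setP Gg) enormBC.
  by have := enorm_dist (c (t + 1)) (c' (t + 1)) (g (c' t)); lra.
Unshelve. all: by end_near. Qed.

(** Nearby slices of the homotopy are uniformly close, by compactness of one period, so
    [has_deck_close] applies in both directions and the property is locally constant in the
    parameter. *)
Lemma freely_homotopic_deck alpha beta g : compact [set: flat_manifold Gamma] ->
  Gamma g -> freely_homotopic alpha beta -> has_deck alpha g <->
    has_deck beta g.
Proof.
move=> cM Gg [H0 [cH0 H01 H0a H0b]].
have [e e0 rad] := uniform_free_radius disc tf cM.
pose H p := H0 (clamp01 p.1, p.2).
have cH : continuous H.
  move=> p; have cl : (clamp01 q.1, q.2) @[q --> p] -->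
      within (`[0%R, 1%R] `*` [set: R]) (nbhs (clamp01 p.1, p.2)).
    have cl0 : (clamp01 q.1, q.2) @[q --> p] --> (clamp01 p.1, p.2).
      have c1 : clamp01 q.1 @[q --> p] --> clamp01 p.1.
        have c0 : q.1 @[q --> p] --> p.1 by exact: cvg_fst.
        exact: (cvg_comp _ _ c0 (@clamp01_continuous R p.1)).
      have c2 : q.2 @[q --> p] --> p.2 by exact: cvg_snd.
      exact: (cvg_pair c1 c2).
    move=> A wA; have := cl0 _ wA; apply: (@filterS _ (nbhs p)) => q; apply.
    by split=> //; exact: (clamp01_itv q.1).
  have/subspace_continuousP := cH0.
  move=> /(_ (clamp01 p.1, p.2) (conj (clamp01_itv p.1) I)) cHp.
  exact: (cvg_comp _ _ cl cHp).
have H1 s t : H (s, t + 1) = H (s, t).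
  by rewrite /H /= H01//; exact: clamp01_itv.
have cHs s : continuous (fun t => H (s, t)).
  move=> t; have c1 : s @[_ --> t] --> s by exact: cvg_cst.
  have c2 : r @[r --> t] --> t by exact: cvg_id.
  exact: (cvg_comp _ _ (cvg_pair c1 c2) (cH (s, t))).
have close s0 : \forall s \near s0,
    forall t, proj_close (e / 4) (H (s0, t)) (H (s, t)).
  (* Both slices are lifted to within [e / 8] of the same point [x], so the lifts are within [e / 4]
     of each other. *)
  have e8 : 0 < e / 8 by rewrite divr_gt0.
  have : \forall s \near s0, `[0%R, 1%R]%classic `<=`
      (fun t => proj_close (e / 4) (H (s0, t)) (H (s, t))).
    move/compact_near_coveringP: (@segment_compact R 0 1).
    move=> /(_ R (nbhs s0) (fun s t
      => proj_close (e / 4) (H (s0, t)) (H (s, t))) _).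
    apply=> t _; set x := repr (H (s0, t)).
    have Ux : \forall p \near (s0, t), exists2 y, prj y = H p & enorm (y - x)
      < e / 8.
      have cHt : H q @[q --> (s0, t)] --> prj x.
        by rewrite /x /orbit_proj reprK; exact: (cH (s0, t)).
      exact: (cHt _ (near_lift Gamma x e8)).
    have [[A B] /= [sA tB] AB] := Ux.
    exists (B, A) => //= -[t' s] /= [Bt' As].
    have [y yH yx] := AB (s, t') (conj As Bt').
    have [y' y'H y'x] := AB (s0, t') (conj (nbhs_singleton sA) Bt').
    exists y', y; split=> //; have := enorm_dist x y' y; rewrite (enormBC x);
      lra.
  apply: filterS => s sub t.
  (* Both slices are shifted by the floor of the same [t], which brings the comparison back to the
     unit segment. *)
  rewrite (periodic1_itv (H1 s0)) (periodic1_itv (H1 s)); apply: sub.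
  have /andP[t0] := floor_itv t; rewrite intrD => /ltW t1.
  by rewrite /= in_itv /= subr_ge0 t0 lerBlDl.
have lc : forall s0, \forall s \near s0,
    has_deck (fun t => H (s, t)) g <-> has_deck (fun t => H (s0, t)) g.
  move=> s0; apply: filterS (close s0) => s cl; split.
    by apply: (has_deck_close rad) => // t; exact: proj_closeC.
  exact: (has_deck_close rad).
have Ha : (fun t => H (0, t)) = alpha.
  by apply/funext => t; rewrite /H /= clamp010.
have Hb : (fun t => H (1, t)) = beta.
  by apply/funext => t; rewrite /H /= clamp011.
rewrite -Ha -Hb; split; exact: (locally_constant_R lc).
Qed.

End FreeHomotopy.

(** * Closed geodesics and holonomy *)

Section Geodesics.
Context {R : realType} {n : nat} (Gamma : isom_group R n).
Context (disc : discrete_isom_group Gamma) (tf : torsion_free Gamma).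
Local Notation V := 'cV[R]_n.
Local Notation prj := (orbit_proj Gamma).
Local Notation tprj := (tangent_proj Gamma).
Implicit Types (x y v w : V) (alpha beta : R -> flat_manifold Gamma).

Definition line x v (t : R) : V := x + t *: v.

Lemma line_continuous x v : continuous (line x v).
Proof.
move=> t; apply: (@cvgD _ _ _ (nbhs t)); first exact: cvg_cst.
by apply: cvgZ; [exact: cvg_id|exact: cvg_cst].
Qed.

Lemma BL_line (B : 'M[R]_n) b x v t :
  BL B b (line x v t) = line (BL B b x) (B *m v) t.
Proof. by rewrite /line BLD scalemxAr. Qed.

(** The germ is carried by one affine element of [Gamma]. Its values at [t] and at the nearby time
    [t + e / 2] determine its effect on the whole line, including the parametrization. *)
Lemma lines_agree x v y w (t : R) : (\forall s \near t, prj (line x v s) = prj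
  (line y w s)) ->
  exists B b, [/\ orthogonal_mx B, Gamma (BL B b), B *m v = w &
    forall s, BL B b (line x v s) = line y w s].
Proof.
move=> agree; have /orbit_projP[g Gg gt] := nbhs_singleton agree.
have yt : line y w s @[s --> t] --> g (line x v t).
  by rewrite gt; exact: line_continuous.
have near_g : \forall s \near t, g (line x v s) = line y w s.
  exact: (lift_germ disc tf Gg (@line_continuous x v t) yt agree).
have [B [b [oB gE]]] := isom_groupP Gg; rewrite gE in Gg gt near_g.
move: near_g => /nbhs_ballP[e /= e0 /(_ (t + e / 2))]; rewrite -ball_normE /=.
rewrite opprD addrA subrr sub0r normrN gtr0_norm ?divr_gt0//.
rewrite ltr_pdivrMr// mulr_natr mulr2n ltrDl => /(_ e0).
move: gt; rewrite !BL_line /line !scalerDl => gt.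
rewrite !addrA gt => /addrI /(scalerI _) Bvw.
have {}Bvw : B *m v = w by apply: Bvw; rewrite gt_eqF// divr_gt0.
exists B, b; split=> // s; rewrite !BL_line Bvw /line.
by move: gt; rewrite Bvw => /addIr ->.
Qed.

(** The line found at time 0 is continued: if it describes [alpha] near a time [t'] close to [t],
    then [lines_agree] identifies it modulo [Gamma] with the local line at [t], so it describes
    [alpha] near [t] as well. *)
Lemma geodesic_lift alpha : geodesic alpha ->
  exists x v, alpha = prj \o line x v.
Proof.
move=> geo; have [x [v xv]] := geo 0; exists x, v; apply/funext => t.
apply: (@nbhs_singleton R t (fun s => alpha s = prj (line x v s))).
apply: (@locally_constant_R R (fun t
  => \forall s \near t, alpha s = prj (line x v s))) 0 t _; last first.
  by apply: filterS xv => s; rewrite subr0.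
move=> {}t; have [Pt|nPt] :=
  pselect (\forall s \near t, alpha s = prj (line x v s)).
  by have := nbhs_interior Pt; apply: filterS => s Ps; split.
have [y [w yw]] := geo t.
have := nbhs_interior yw; apply: filterS => t' yw'; split=> // Pt'; exfalso.
apply: nPt.
have yE s : y + (s - t) *: w = line (y - t *: w) w s.
  by rewrite /line scalerBl addrA addrAC.
have [|B [b [_ Gg _ agree]]] := @lines_agree x v (y - t *: w) w t'.
  by apply: filterS2 Pt' yw' => s <- ->; rewrite yE.
by apply: filterS yw => s ->; rewrite yE -agree orbit_proj_isom.
Qed.

Lemma geodesic_line x v : geodesic (prj \o line x v).
Proof.
move=> t; exists (line x v t), v; apply: filterE => s /=.
by rewrite /line -addrA -scalerDl subrKC.
Qed.

Lemma tangent_proj_BL (B : 'M[R]_n) b x w : Gamma (BL B b) ->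
  tprj (BL B b x) (B *m w) = tprj x w.
Proof.
move=> Gg; apply/esym/tangent_projP; exists (BL B b) => //.
by rewrite BLD addrC addKr.
Qed.

Lemma tangent_proj_inj x w w' : tprj x w = tprj x w' -> w = w'.
Proof.
move=> /tangent_projP[g Gg [gx <-]]; rewrite (discrete_free disc tf Gg gx).
by rewrite addrC addKr.
Qed.

Lemma is_derive_line x v t :
  derivable (line x v) t 1 /\ derive1 (line x v) t = v.
Proof.
have cv : h^-1 *: ((line x v \o shift t) (h *: 1) - line x v t) @[h -->
  0^'] --> v.
  apply: cvg_near_cst; near=> h.
  rewrite /= /line [h *: 1]mulr1 scalerDl.
  rewrite (_ : _ - _ = h *: v); last by vring.
  rewrite scalerA mulVf ?scale1r//; near: h; exact: nbhs_dnbhs_neq.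
by split; [apply/cvg_ex; exists v|rewrite derive1E; exact: cvg_lim].
Unshelve. all: by end_near. Qed.

(** [velocity] is a choice, so uniqueness is the point: any differentiable lift equals near [t] the
    line moved by an element of [Gamma], whose differential identifies the two tangent vectors. *)
Lemma velocity_line x v t : velocity (prj \o line x v) t = tprj (line x v t) v.
Proof.
have vel : is_velocity (prj \o line x v) t (tprj (line x v t) v).
  have [d dv] := is_derive_line x v t.
  by exists (line x v); split=> //; rewrite ?dv//; exact: filterE.
rewrite /velocity; apply: xget_unique => //.
move=> _ [c [pc dc ->]].
have cc : {for t, continuous c}.
  by apply: differentiable_continuous; exact/derivable1_diffP.
have /= /orbit_projP[g Gg gt] := nbhs_singleton pc.
have ct : c s @[s --> t] --> g (line x v t) by rewrite gt.
have cE : \forall s \near t, g (line x v s) = c s.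
  exact: (lift_germ disc tf Gg (@line_continuous x v t) ct pc).
have [B [b [oB gE]]] := isom_groupP Gg; rewrite gE in Gg gt cE.
have [dl dvl] := is_derive_line (BL B b x) (B *m v) t.
rewrite -gt derive1E.
have -> : 'D_1 c t = 'D_1 (line (BL B b x) (B *m v)) t.
  apply: near_eq_derive.
  by apply: filterS cE => s <-; rewrite BL_line.
by rewrite -derive1E dvl tangent_proj_BL.
Qed.

Lemma tnorm_tangent_proj x v : tnorm (tprj x v) = enorm v.
Proof.
rewrite /tnorm; have := reprK (tprj x v); case: (repr _) => y w /= /esym.
move=> /tangent_projP[g Gg [_ <-]].
by rewrite (isom_setP Gg) addrC addKr.
Qed.

Lemma curve_length_line x v : curve_length (prj \o line x v) = enorm v.
Proof.
rewrite /curve_length; under eq_Rintegral do rewrite velocity_line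
  tnorm_tangent_proj.
rewrite Rintegral_cst//= lebesgue_measure_itv /= lte_fin ltr01.
by rewrite /= subr0 mulr1.
Qed.

Lemma closed_geodesic_lift alpha : closed_geodesic alpha ->
  exists x v B b, [/\ alpha = prj \o line x v, orthogonal_mx B, Gamma (BL B b),
    B *m v = v & BL B b x = x + v].
Proof.
move=> [/geodesic_lift[x [v ->]] per].
(* Advancing time by one period replaces the line through [x] by the line through [x + v], with the
   same direction and the same projection. *)
have [|B [b [oB Gg Bv agree]]] := @lines_agree x v (x + v) v 0.
  apply: filterE => t; rewrite -[LHS](per t) /= /line scalerDl scale1r.
  by rewrite addrCA addrC addrAC.
exists x, v, B, b; split=> //.
by have := agree 0; rewrite /line !scale0r !addr0.
Qed.

(** * Parallel fields and holonomy *)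

Lemma parallel_along_unique alpha F F' t0 :
  parallel_along alpha F -> parallel_along alpha F' -> F t0 = F' t0 -> F = F'.
Proof.
move=> pF pF' F0; apply/funext => t.
apply: (@locally_constant_R _ (fun t => F t = F' t)) F0 => {}t.
have [c [w [cc nc]]] := pF t; have [c' [w' [cc' nc']]] := pF' t.
have [act Fct] := nbhs_singleton nc; have [act' Fct'] := nbhs_singleton nc'.
have [g Gg gt] : exists2 g, Gamma g & g (c t) = c' t.
  by apply/orbit_projP; rewrite -act -act'.
have ct : c' s @[s --> t] --> g (c t) by rewrite gt; exact: cc'.
have [B [b [oB gE]]] := isom_groupP Gg.
(* Along lifts related by [g], equality of the two fields reduces to [B *m w = w'], a condition free
   of the time [s]; it is therefore locally constant. *)
have key s : g (c s) = c' s -> F s = tprj (c s) w -> F' s = tprj (c' s) w' ->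
    F s = F' s <-> B *m w = w'.
  move=> gs -> ->; rewrite -gs gE.
  rewrite -(tangent_proj_BL (c s) w (B := B) (b := b)) -?gE//.
  by split=> [/tangent_proj_inj|->].
have near_g : \forall s \near t, g (c s) = c' s.
  apply: (lift_germ disc tf Gg (cc t) ct).
  by apply: filterS2 nc nc' => s [<- _] [<- _].
apply: filterS3 nc nc' near_g => s [_ Fs] [_ F's] gs.
by rewrite (key s)// (key t).
Qed.

Lemma parallel_transport_line x v (B : 'M[R]_n) b w : orthogonal_mx B ->
  Gamma (BL B b) -> BL B b x = x + v ->
  parallel_transport (prj \o line x v) (tprj x w) (tprj x (B^T *m w)).
Proof.
move=> oB Gg gx; exists (fun t => tprj (line x v t) w); split.
- move=> t; exists (line x v), w; split; first exact: line_continuous.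
  exact: filterE.
- by rewrite /line scale0r addr0.
- by rewrite /line scale1r -gx -{1}(orthogonal_mxKV w oB) tangent_proj_BL.
Qed.

(** The holonomy may be read at any point [x'] above the start. The element of [Gamma] taking [x] to
    [x'] conjugates the transport [B^T] by its linear part and moves [v] accordingly, which leaves
    the class unchanged. *)
Lemma is_holonomy_line x v (B : 'M[R]_n) b C : orthogonal_mx B ->
  Gamma (BL B b) -> BL B b x = x + v ->
  is_holonomy (prj \o line x v) C <-> C = perp_class B v.
Proof.
move=> oB Gg gx; have x0 : line x v 0 = x by rewrite /line scale0r addr0.
split=> [[x' [v' [A [vel tr ->]]]]|->]; last first.
  exists x, v, B^T; split; first by rewrite velocity_line x0.
    by move=> w; exact: parallel_transport_line oB Gg gx.
  by rewrite perp_class_tr.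
move: vel; rewrite velocity_line x0 => /tangent_projP[g Gg' [gx' gv]].
have [B' [b' [oB' gE]]] := isom_groupP Gg'; rewrite gE in Gg' gx' gv.
have v'E : v' = B' *m v by rewrite -gv BLD addrC addKr.
have -> : A = B' *m B^T *m B'^T.
  apply: mulmx_ext => w; apply: (@tangent_proj_inj x').
  rewrite -!mulmxA -[in RHS]gx' tangent_proj_BL//.
  have [F [pF F0 F1]] := tr w.
  have [F' [pF' F'0 F'1]] := parallel_transport_line (B'^T *m w) oB Gg gx.
  suff FF' : F = F' by rewrite -F1 -F'1 FF'.
  apply: (parallel_along_unique (t0 := 0) pF pF').
  by rewrite F0 F'0 -gx' -{1}(orthogonal_mxKV w oB') tangent_proj_BL.
by rewrite v'E perp_class_conj// perp_class_tr.
Qed.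

End Geodesics.

(** * Spectra *)

Section Spectra.
Context {R : realType} {n : nat} (Gamma : isom_group R n).
Context (disc : discrete_isom_group Gamma) (tf : torsion_free Gamma).
Context (cM : compact [set: flat_manifold Gamma]).
Local Notation V := 'cV[R]_n.
Local Notation prj := (orbit_proj Gamma).
Implicit Types (B : 'M[R]_n) (b u x v : V) (alpha : R -> flat_manifold Gamma).

Lemma axis_line B b u : axis B b u = line (axis B b u 0) (bplus B b).
Proof. by apply/funext => t; rewrite axisE. Qed.

Lemma BL_axis0 B b u : orthogonal_mx B -> fixed_space B u ->
  BL B b (axis B b u 0) = axis B b u 0 + bplus B b.
Proof. by move=> oB Fu; rewrite BL_axis// add0r axisE scale1r. Qed.

Lemma axis_closed_geodesic B b u : orthogonal_mx B -> Gamma (BL B b) ->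
  fixed_space B u -> closed_geodesic (prj \o axis B b u).
Proof.
move=> oB Gg Fu; split; first by rewrite axis_line; exact: geodesic_line.
by move=> t; rewrite /= -BL_axis// orbit_proj_isom.
Qed.

Lemma curve_length_axis B b u :
  curve_length (prj \o axis B b u) = enorm (bplus B b).
Proof. by rewrite axis_line curve_length_line. Qed.

Lemma is_holonomy_axis B b u C : orthogonal_mx B -> Gamma (BL B b) ->
  fixed_space B u ->
  is_holonomy (prj \o axis B b u) C <-> C = perp_class B (bplus B b).
Proof.
move=> oB Gg Fu; rewrite axis_line.
by apply: (is_holonomy_line disc tf _ oB Gg); rewrite BL_axis0.
Qed.

Lemma closed_geodesic_axis alpha : closed_geodesic alpha ->
  exists B b u, [/\ orthogonal_mx B, Gamma (BL B b), fixed_space B u &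
    alpha = prj \o axis B b u].
Proof.
move=> /(closed_geodesic_lift disc tf)[x [v [B [b [-> oB Gg Bv gx]]]]].
have [_ [u Fu uE]] := axis_of_translated_line oB Bv gx.
by exists B, b, u; split=> //; rewrite uE.
Qed.

Lemma is_complex_length_axis B b u z : orthogonal_mx B -> Gamma (BL B b) ->
  fixed_space B u ->
  is_complex_length (prj \o axis B b u) z <->
  z = (enorm (bplus B b), perp_class B (bplus B b)).
Proof.
move=> oB Gg Fu; rewrite /is_complex_length curve_length_axis
  is_holonomy_axis//.
by case: z => l C /=; split=> [[<- <-]|[-> ->]].
Qed.

(** On a stable line the isometry acts by [s] to [s0 + s] or [s] to [s0 - s]; freeness excludes the
    reflection. The identity is set apart because it stabilizes every line while its axes shrink to
    points. *)
Lemma stable_line_axis B b (l : set V) : orthogonal_mx B -> Gamma (BL B b) ->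
  BL B b <> id -> is_line l -> BL B b @` l `<=` l ->
  exists2 u, fixed_space B u & l = range (axis B b u).
Proof.
move=> oB Gg gid [p [v [v0 lE]]] stab.
have nofix x : BL B b x <> x by move=> gx;
  exact/gid/(discrete_free disc tf Gg gx).
have inl t : exists s, BL B b (line p v t) = line p v s.
  have : (BL B b @` l) (BL B b (line p v t)) by exists (line p v t);
    rewrite // lE; exists t.
  by move=> /stab; rewrite lE => -[s _ <-]; exists s.
have [s0 gs0] := inl 0; have [s1 gs1] := inl 1.
move: gs0 gs1; rewrite !BL_line /line !scale0r !addr0 scale1r => gs0.
rewrite gs0 -addrA => /addrI gs1.
have {gs1} Bv : B *m v = (s1 - s0) *: v
  by rewrite scalerBl -gs1 addrAC subrr add0r.
have sgn : (s1 - s0) ^+ 2 = 1.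
  have := congr1 (fun t => t ^+ 2) (enorm_orthogonal v oB).
  rewrite Bv !enorm_sqr dotpZl dotpZr mulrA -expr2 -[RHS]mul1r -!enorm_sqr.
  by apply: mulIf; rewrite expf_neq0// gt_eqF// enorm_gt0.
have {}Bv : B *m v = v.
  move: sgn => /eqP; rewrite sqrf_eq1 => /orP[/eqP e|/eqP e];
    first by rewrite Bv e scale1r.
  (* The reflection [s] to [s0 - s] fixes the midpoint [s0 / 2]. *)
  exfalso; apply: (nofix (line p v (s0 / 2))).
  rewrite BL_line gs0 Bv e /line; apply/colP => i; rewrite !colv_coordE.
  by field.
have [bv [u Fu uE]] : bplus B b = s0 *: v /\
    exists2 u, fixed_space B u & axis B b u = fun t => p + t *: (s0 *: v).
  by apply: axis_of_translated_line => //; rewrite -scalemxAr Bv.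
exists u => //; rewrite uE lE.
have s0n : s0 != 0.
  by apply/eqP => s00; apply: (nofix p); rewrite gs0 s00 scale0r addr0.
apply/seteqP; split=> _ [t _ <-].
  by exists (t / s0) => //; rewrite scalerA divfK.
by exists (t * s0) => //; rewrite scalerA.
Qed.

(** * Counting free homotopy classes *)

Lemma has_deck_axis B b u : orthogonal_mx B -> fixed_space B u ->
  has_deck (prj \o axis B b u) (BL B b).
Proof.
move=> oB Fu; exists (axis B b u); last by split=> // t; rewrite BL_axis.
by rewrite axis_line; exact: line_continuous.
Qed.

Lemma closed_geodesic_path alpha : closed_geodesic alpha -> closed_path alpha.
Proof.
move=> [/(geodesic_lift disc tf)[x [v ->]] per]; split=> // t.
apply: continuous_comp; first exact: line_continuous.
exact: orbit_proj_continuous.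
Qed.

Definition deck_class g : set (R -> flat_manifold Gamma) :=
  [set beta | closed_path beta /\ has_deck beta g].

Lemma free_homotopy_class_deck alpha g : Gamma g -> has_deck alpha g ->
  [set beta | closed_path beta /\ freely_homotopic alpha beta] = deck_class g.
Proof.
move=> Gg ag; apply/seteqP; split=> beta [cb] hb; split=> //.
  exact/(freely_homotopic_deck disc tf cM Gg hb).
exact: has_deck_homotopic ag hb.
Qed.

(** The bijection sends a representative [g] to [deck_class g]. The predicates [Q] on curves and [q]
    on coefficients are left abstract so that lengths and complex lengths are counted by one
    argument. *)
Lemma card_free_homotopy_classes (Q : (R -> flat_manifold Gamma) -> Prop)
    (q : 'M[R]_n -> V -> Prop) (S : set (V -> V)) :
  (forall B b u, orthogonal_mx B -> Gamma (BL B b) -> fixed_space B u ->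
    Q (prj \o axis B b u) <-> q B b) ->
  full_representatives Gamma S ->
  [set K | is_free_homotopy_class K /\
    exists alpha, [/\ K alpha, closed_geodesic alpha & Q alpha]] #=
  [set g | S g /\ exists B b, [/\ orthogonal_mx B, g = BL B b & q B b]].
Proof.
move=> Qq [SG Sex]; set T := (X in _ #= X).
have TG g : T g -> Gamma g by move=> [/SG].
have axis0 B b : orthogonal_mx B -> Gamma (BL B b) ->
    deck_class (BL B b) (prj \o axis B b 0).
  move=> oB Gg; split; last by apply: has_deck_axis => //; exact: fixed_space0.
  by apply: closed_geodesic_path; apply: axis_closed_geodesic => //;
    exact: fixed_space0.
rewrite (_ : [set K | _] = deck_class @` T); last first.
  apply/seteqP; split=> [K [[alpha0 c0 ->]]|_ [g Tg <-]].
    move=> [alpha [[ca h0] ga Qa]].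
    have [B [b [u [oB Gg Fu aE]]]] := closed_geodesic_axis ga.
    have [h [[Sh [k Gk kgh]] _]] := Sex _ Gg.
    have Gh := SG _ Sh; have [B' [b' [oB' hE]]] := isom_groupP Gh.
    have deck_h : has_deck alpha h.
      by rewrite aE; apply: has_deck_conj Gk kgh _; exact: has_deck_axis.
    exists h; last first.
      by rewrite (free_homotopy_class_deck Gh)//;
        exact/(freely_homotopic_deck disc tf cM Gh h0).
    split=> //; exists B', b'; split=> //.
    have [kK [kb [okK kE]]] := isom_groupP Gk.
    have lift t : BL B' b' (k (axis B b u t)) = k (axis B b u (t + 1)).
      by rewrite -hE -BL_axis//; exact/esym/(congr1 (@^~ (axis B b u t)) kgh).
    (* The conjugating element [k] moves the axis to a line that [h] translates by one period, hence
       to an axis of [h] with the same projection; this transfers [Q] to the representative [h]. *)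
    pose x := k (axis B b u 0); pose v := kK *m bplus B b.
    have klin t : k (axis B b u t) = line x v t.
      by rewrite axis_line kE BL_line -kE.
    have gx t : BL B' b' (line x v t) = line x v (t + 1) by rewrite -!klin.
    have B'v : B' *m v = v.
      move: (gx 1) (gx 0); rewrite !BL_line /line add0r scale0r !scale1r addr0
        => gx1 gx0.
      by move: gx1; rewrite gx0 scalerDl scale1r addrA => /addrI.
    have [|_ [u' Fu' u'E]] := @axis_of_translated_line R n B' b' x v oB' B'v.
      by have := gx 0; rewrite /line add0r scale1r scale0r addr0.
    apply/(Qq B' b' u') => //; first by rewrite -hE.
    suff -> : prj \o axis B' b' u' = alpha by [].
    rewrite aE; apply/funext => t; rewrite /= u'E -/(line x v t) -klin.
    by rewrite orbit_proj_isom.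
  have Gg := TG g Tg; have [Sg [B [b [oB gE qB]]]] := Tg.
  rewrite gE in Gg *; have [cp hd] := axis0 B b oB Gg; split.
    by exists (prj \o axis B b 0) => //; rewrite (free_homotopy_class_deck Gg).
  exists (prj \o axis B b 0); split=> //.
    by apply: axis_closed_geodesic => //; exact: fixed_space0.
  by apply/Qq => //; exact: fixed_space0.
apply: inj_card_eq => g h /set_mem Tg /set_mem Th gh.
have Gg := TG g Tg; have Gh := TG h Th.
have [Sg [B [b [oB gE _]]]] := Tg; have [Sh _] := Th.
have [_ gg] : deck_class g (prj \o axis B b 0).
  by rewrite gE; apply: axis0 => //; rewrite -gE.
have [_ hh] : deck_class h (prj \o axis B b 0).
  by rewrite -gh gE; apply: axis0 => //; rewrite -gE.
(* Elements with a closed path in common are conjugate, so both [g] and [h] are the unique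
   representative of the class of [g]. *)
have [k [_ kuniq]] := Sex g Gg.
rewrite -(kuniq g); last by split=> //; exists id => //; exact: isom_id.
by apply: kuniq; split=> //; exact: has_deck_conjugate gg hh.
Qed.

End Spectra.

Theorem proposition2p1 (R : realType) (n : nat) (Gamma : isom_group R n)
    (hGamma : bieberbach Gamma) :
  (* (i) *)
  (forall (B : 'M[R]_n) (b : 'cV[R]_n), orthogonal_mx B -> Gamma (BL B b) ->
     [/\ forall u, fixed_space B u ->
           BL B b @` range (axis B b u) = range (axis B b u),
         forall u, fixed_space B u ->
           forall t, BL B b (axis B b u t) = axis B b u (t + 1) &
         BL B b <> id ->
           forall l, is_line l -> BL B b @` l `<=` l ->
           exists2 u, fixed_space B u & l = range (axis B b u)]) /\
  (* (ii) *)
  ((forall (B : 'M[R]_n) (b u : 'cV[R]_n),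
      orthogonal_mx B -> Gamma (BL B b) -> fixed_space B u ->
      closed_geodesic (orbit_proj Gamma \o axis B b u) /\
      curve_length (orbit_proj Gamma \o axis B b u) = enorm (bplus B b)) /\
   (forall alpha : R -> flat_manifold Gamma, closed_geodesic alpha ->
      exists (B : 'M[R]_n) (b u : 'cV[R]_n),
        [/\ orthogonal_mx B, Gamma (BL B b), fixed_space B u &
            alpha = orbit_proj Gamma \o axis B b u])) /\
  (* (iii) *)
  (forall (B : 'M[R]_n) (b u : 'cV[R]_n),
     orthogonal_mx B -> Gamma (BL B b) -> fixed_space B u ->
     freely_homotopic (orbit_proj Gamma \o axis B b u)
                      (orbit_proj Gamma \o axis B b 0) /\
     forall C, is_holonomy (orbit_proj Gamma \o axis B b u) C <->
               C = perp_class B (bplus B b)) /\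
  (* (iv) *)
  (L_spectrum Gamma =
     [set l | exists (B : 'M[R]_n) (b : 'cV[R]_n),
        [/\ orthogonal_mx B, Gamma (BL B b) & l = enorm (bplus B b)]] /\
   Lc_spectrum Gamma =
     [set z | exists (B : 'M[R]_n) (b : 'cV[R]_n),
        [/\ orthogonal_mx B, Gamma (BL B b) &
            z = (enorm (bplus B b), perp_class B (bplus B b))]]) /\
  (* (v) *)
  (forall S : set ('cV[R]_n -> 'cV[R]_n), full_representatives Gamma S ->
     (forall l, classes_of_length Gamma l #=
        [set g | S g /\ exists (B : 'M[R]_n) (b : 'cV[R]_n),
           [/\ orthogonal_mx B, g = BL B b & l = enorm (bplus B b)]]) /\
     (forall z, classes_of_complex_length Gamma z #=
        [set g | S g /\ exists (B : 'M[R]_n) (b : 'cV[R]_n),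
           [/\ orthogonal_mx B, g = BL B b &
               z = (enorm (bplus B b), perp_class B (bplus B b))]])).
Proof.
have [disc cM tf] := hGamma; split; last split; last split; last split.
- move=> B b oB Gg; split=> [u Fu|u Fu t|gid l];
    last exact: (stable_line_axis disc tf oB Gg).
    apply/seteqP; split=> [_ [_ [t _ <-] <-]|_ [t _ <-]].
      by exists (t + 1); rewrite // BL_axis.
    by exists (axis B b u (t - 1)); [exists (t - 1)|rewrite BL_axis// subrK].
  exact: BL_axis.
- split=> [B b u oB Gg Fu|alpha]; last exact: (closed_geodesic_axis disc tf).
  by split; [exact: axis_closed_geodesic|exact: (curve_length_axis disc tf)].
- move=> B b u oB Gg Fu; split=> [|C]; last exact: (is_holonomy_axis disc tf).
  have F0 := fixed_space0 B.
  by apply: (has_deck_homotopic Gg); exact: has_deck_axis.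
- split; apply/seteqP; split.
  + move=> _ [alpha ga <-].
    have [B [b [u [oB Gg Fu ->]]]] := closed_geodesic_axis disc tf ga.
    by exists B, b; rewrite (curve_length_axis disc tf).
  + move=> _ [B [b [oB Gg ->]]]; have F0 := fixed_space0 B.
    exists (orbit_proj Gamma \o axis B b 0);
      last exact: (curve_length_axis disc tf).
    exact: axis_closed_geodesic.
  + move=> z [alpha ga]; have [B [b [u [oB Gg Fu ->]]]] :=
      closed_geodesic_axis disc tf ga.
    by move/(is_complex_length_axis disc tf z oB Gg Fu) => ->; exists B, b.
  + move=> _ [B [b [oB Gg ->]]]; have F0 := fixed_space0 B.
    exists (orbit_proj Gamma \o axis B b 0); first exact: axis_closed_geodesic.
    exact/(is_complex_length_axis disc tf _ oB Gg F0).
- move=> S rS; split=> z.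
  + apply: (card_free_homotopy_classes disc tf cM (Q := fun alpha
      => curve_length alpha = z)) => //.
    by move=> B b u *; rewrite (curve_length_axis disc tf)//; split.
  + apply: (card_free_homotopy_classes disc tf cM (Q := fun alpha
      => is_complex_length alpha z)) => //.
    by move=> B b u *; exact: is_complex_length_axis.
Qed.
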